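(* Consider the distributed estimation setting described in the context, with $n$ agents, $M$ fixed features, $c$ measurements per agent per time step, network matrix $\mathbf{P}=\mathbf{I}_n-\alpha\mathbf{L}$, and each agent $i$ running $$\hat{\boldsymbol{\theta}}_{i,t+1}=\sum_{j=1}^n \mathbf{P}_{ij}\hat{\boldsymbol{\theta}}_{j,t}+\alpha\,\mathbf{H}_{i,t}^\top(\mathbf{y}_{i,t}-\mathbf{H}_{i,t}\hat{\boldsymbol{\theta}}_{i,t})$$ from initial estimates with finite second moments. Let $\mathbf{e}_t=[\mathbf{e}_{1,t}^\top,\dots,\mathbf{e}_{n,t}^\top]^\top$ with $\mathbf{e}_{i,t}=\hat{\boldsymbol{\theta}}_{i,t}-\boldsymbol{\theta}$, and let $\mathbf{B}=\mathbf{L}\otimes\mathbf{I}_M+c\,\mathrm{diag}[\mathbf{G}_1,\dots,\mathbf{G}_n]$. If $$\alpha<\frac{2\lambda_{Mn}(\mathbf{B})}{(\lambda_1(\mathbf{L})+2Mc)^2},$$ then $$\limsup_{t\to\infty}\mathbb{E}[\mathbf{e}_t^\top\mathbf{e}_t]\le\frac{2\alpha cMn\sigma_v^2}{2\lambda_{Mn}(\mathbf{B})-\alpha(\lambda_1(\mathbf{L})+2Mc)^2},$$ where the expectation is over the inputs and the observation noise.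
   Context: Setting: an unknown parameter $\boldsymbol{\theta}\in\mathbb{R}^M$. Fixed features $\boldsymbol{\omega}_1,\dots,\boldsymbol{\omega}_M$ and a feature map $\phi(\mathbf{x},\boldsymbol{\omega})$ with $\sup_{\mathbf{x},\boldsymbol{\omega}}|\phi(\mathbf{x},\boldsymbol{\omega})|\le\sqrt2$. There are $n$ agents; at each time $t$, agent $i\in\{1,\dots,n\}$ receives $c$ random inputs $\mathbf{x}_{1,i,t},\dots,\mathbf{x}_{c,i,t}\in\mathbb{R}^d$ and forms $\mathbf{H}_{i,t}\in\mathbb{R}^{c\times M}$ with $(j,l)$ entry $\phi(\mathbf{x}_{j,i,t},\boldsymbol{\omega}_l)$, and observes $\mathbf{y}_{i,t}=\mathbf{H}_{i,t}\boldsymbol{\theta}+\mathbf{v}_{i,t}$ with $\mathbb{E}[\mathbf{v}_{i,t}]=\mathbf{0}$, $\mathbb{E}[\mathbf{v}_{i,t}\mathbf{v}_{i,t}^\top]=\sigma_v^2\mathbf{I}_c$. The inputs and noise at time $t$ are independent of each other and of everything generated before time $t$, and the input distributions do not depend on $t$. Define $\mathbf{G}_i=c^{-1}\mathbb{E}[\mathbf{H}_{i,t}^\top\mathbf{H}_{i,t}]$; each $\mathbf{G}_i$ has rank strictly less than $M$ while $\sum_{i=1}^n\mathbf{G}_i$ is invertible. Network: the communication graph is undirected and connected, $\mathbf{L}$ is its graph Laplacian, $\mathbf{P}=\mathbf{I}_n-\alpha\mathbf{L}$ with $0<\alpha<1/\mathrm{deg}$ ($\mathrm{deg}$ = maximum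 degree); the same $\alpha$ is the step size. $\lambda_i(\cdot)$ denotes the $i$-th largest eigenvalue, so $\lambda_{Mn}(\mathbf{B})$ is the smallest eigenvalue of the $Mn\times Mn$ matrix $\mathbf{B}$ and $\lambda_1(\mathbf{L})$ the largest eigenvalue of $\mathbf{L}$. *)

(* Defs.v *)
From HB Require Import structures.
From mathcomp Require Import all_boot all_order all_algebra.
From mathcomp Require Import all_classical all_reals all_analysis.
Set Implicit Arguments. Unset Strict Implicit. Unset Printing Implicit Defensive.
Import Order.TTheory GRing.Theory Num.Theory.
Local Open Scope classical_set_scope.
Local Open Scope ring_scope.

Definition gdeg (n : nat) (adj : rel 'I_n) (i : 'I_n) : nat := #|[pred j | adj i j]|.

Definition maxdeg (n : nat) (adj : rel 'I_n) : nat := \max_(i < n) gdeg adj i.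

Definition laplacian (R : ringType) (n : nat) (adj : rel 'I_n) : 'M[R]_n :=
  \matrix_(i, j) (if i == j then (gdeg adj i)%:R else - (adj i j)%:R).

Definition netP (R : ringType) (n : nat) (adj : rel 'I_n) (alpha : R) : 'M[R]_n :=
  1%:M - alpha *: laplacian R adj.

(* the index p of 'I_(n*M) corresponds to the pair (agent i, coordinate k);
   this is the same bijection as used by mathcomp's mxvec. *)
Definition kidx (n M : nat) (p : 'I_(n * M)) : 'I_n * 'I_M :=
  enum_val (cast_ord (esym (mxvec_cast n M)) p).

(* B = L (x) I_M + c diag[G_1, ..., G_n] *)
Definition Bmat (R : ringType) (n M c : nat) (L : 'M[R]_n) (G : 'I_n -> 'M[R]_M)
  : 'M[R]_(n * M) :=
  \matrix_(p, q)
    (L (kidx p).1 (kidx q).1 * ((kidx p).2 == (kidx q).2)%:R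
     + c%:R * ((kidx p).1 == (kidx q).1)%:R * G (kidx p).1 (kidx p).2 (kidx q).2).

Definition is_min_eigenvalue (R : realFieldType) (m : nat) (A : 'M[R]_m) (l : R) :=
  eigenvalue A l /\ forall a, eigenvalue A a -> l <= a.
Definition is_max_eigenvalue (R : realFieldType) (m : nat) (A : 'M[R]_m) (l : R) :=
  eigenvalue A l /\ forall a, eigenvalue A a -> a <= l.

Definition Hmat (R : ringType) (X W : Type) (c M : nat) (phi : X -> W -> R)
  (omega : 'I_M -> W) (xs : 'I_c -> X) : 'M[R]_(c, M) :=
  \matrix_(j, l) phi (xs j) (omega l).

Fixpoint est (R : ringType) (T X W : Type) (n M c : nat) (phi : X -> W -> R)
  (omega : 'I_M -> W) (theta : 'cV[R]_M) (Pm : 'M[R]_n) (alpha : R)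
  (x : nat -> 'I_n -> 'I_c -> T -> X) (v : nat -> 'I_n -> 'I_c -> T -> R)
  (th0 : 'I_n -> T -> 'cV[R]_M) (t : nat) : 'I_n -> T -> 'cV[R]_M :=
  match t with
  | 0 => th0
  | t'.+1 => fun i w =>
      let prev := est phi omega theta Pm alpha x v th0 t' in
      let H := Hmat phi omega (fun j => x t' i j w) in
      let y := H *m theta + \col_k v t' i k w in
      \sum_(j < n) Pm i j *: prev j w + alpha *: (H^T *m (y - H *m prev i w))
  end.

Definition gen_class (dY : measure_display) (Y : measurableType dY) (T I : Type)
  (f : I -> T -> Y) : set (set T) :=
  [set S | exists a, exists2 A, measurable A & S = f a @^-1` A].

Definition indep3 (d : measure_display) (T : measurableType d) (R : realType)
  (P : probability T R) (F1 F2 F3 : set (set T)) :=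
  forall A B C, F1 A -> F2 B -> F3 C ->
    P (A `&` B `&` C) = (P A * P B * P C)%E.

(* Main.v *)
(* The stacked error obeys e' = e - alpha A e + alpha N, where the random gain
   A = L (x) I + diag (H_i^T H_i) has mean B and N = (H_i^T v_i)_i.  Pointwise
   0 <= A <= K := lambda_1(L) + 2 M c, so |A e|^2 <= K^2 |e|^2.  Independence of
   the inputs, the noise and the past kills the cross term between N and e and
   replaces A by B in E[e^T A e], which is at least lambda_min(B) E|e|^2.  Hence
   E|e'|^2 <= rho E|e|^2 + 2 alpha^2 c M n sigma^2 with
   rho = 1 - 2 alpha lambda_min(B) + alpha^2 K^2 < 1, and the limsup is bounded
   by the fixed point of this affine recursion. *)
Require Import Defs.
From HB Require Import structures.
From mathcomp Require Import all_boot all_order all_algebra.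
From mathcomp Require Import spectral sesquilinear complex.
From mathcomp Require Import all_classical all_reals all_analysis.
From mathcomp Require Import measurable_realfun ring lra.
Import Order.TTheory GRing.Theory Num.Theory.
Local Open Scope classical_set_scope.
Local Open Scope ring_scope.

Set Implicit Arguments.
Unset Strict Implicit.

(** * Quadratic forms of symmetric matrices *)

(** Each realization of the gain A is only known to be positive semidefinite, so the contraction
    cannot be pointwise: it comes from averaging the first-order term. In the second-order term A
    occurs twice and its mean does not suffice, hence the pointwise bound K there. The 2Mc in K is
    the bound for a Gram matrix of c rows with M entries of square at most 2; the noise constant
    counts Mn coordinates with c noise entries each, again with weight at most 2. Since 1 - rho =
    alpha (2 lambda_min(B) - alpha K^2), one power of alpha cancels in the fixed point.

    The obstacle is that independence is given for events, whereas it is applied to signed unbounded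
    variables. Every quadratic quantity is therefore expanded entrywise into scalar monomials, each
    a product of an input factor, a noise factor and a past factor, and only such monomials are
    factorized. Integrability must be carried along, because the real-valued integral is split only
    over integrable summands; this is why second moments of the error are propagated in time. *)

Lemma eigenvalue_fmorph (F K : fieldType) (f : {rmorphism F -> K}) n
  (A : 'M[F]_n) (a : F) : eigenvalue (map_mx f A) (f a) = eigenvalue A a.
Proof. by rewrite !eigenvalue_root_char -map_char_poly fmorph_root. Qed.

(** The spectral theorem is applied over [R[i]]: the embedded matrix is hermitian, so its spectrum
    is real and descends to eigenvalues of [A]. In the eigenbasis both forms are sums of the squared
    moduli of the same coordinates, with weights [D 0 i] and [l]. *)
Lemma symmetric_form_ge (R : rcfType) n (A : 'M[R]_n) (l : R) :
  A^T = A -> (forall a, eigenvalue A a -> l <= a) ->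
  forall u : 'rV[R]_n, l * (u *m u^T) 0 0 <= (u *m A *m u^T) 0 0.
Proof.
move=> Asym Al u; pose f : {rmorphism R -> R[i]} := real_complex R.
have freal x : f x \is Num.real by apply/complex_realP; exists x.
have fconj x : (f x)^* = f x by apply/CrealP.
pose A' := map_mx f A.
have A'herm : A' \is hermsymmx.
  apply: realsym_hermsym.
    apply/is_hermitianmxP; rewrite expr0 scale1r; apply/matrixP => i j.
    by rewrite !mxE -{1}Asym mxE.
  by apply/mxOverP => i j; rewrite mxE.
have /mxOverP Dreal := hermitian_spectral_diag_real A'herm.
have /orthomx_spectralP A'E := hermitian_normalmx A'herm.
move: Dreal A'E; set P := spectralmx A'; set D := spectral_diag A' => Dreal A'E.
have Pun : P \is unitarymx by exact: spectral_unitarymx.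
have PU : P \in unitmx by exact: spectral_unit.
(* Row [i] of the unitary matrix [P] is a left eigenvector for [D 0 i], nonzero because [P] is
   invertible. *)
have Dge i : f l <= D 0 i.
  have : eigenvalue A' (D 0 i).
    apply/eigenvalueP; exists (row i P).
      rewrite -row_mul {1}A'E !mulmxA mulmxV// mul1mx.
      by apply/rowP => j; rewrite !mxE (bigD1 i)//= big1 ?addr0 ?mxE ?eqxx ?mulr1n//
        => k ki; rewrite !mxE eq_sym (negPf ki) mulr0n mul0r.
    apply/eqP => Pi0.
    have : row i P *m invmx P = row i 1%:M by rewrite -row_mul mulmxV.
    rewrite Pi0 mul0mx => /rowP/(_ i)/esym/eqP.
    by rewrite !mxE eqxx oner_eq0.
  have [d Dd] : exists d, D 0 i = f d.
    by have /complex_realP[d ->] := Dreal 0 i; exists d.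
  by rewrite Dd eigenvalue_fmorph lecR => /Al.
pose u' := map_mx f u.
pose w := u' *m invmx P.
have u'T : u'^T = (u' ^t*)%sesqui.
  by apply/matrixP => i j; rewrite !mxE fconj.
have wtE : (w ^t*)%sesqui = P *m u'^T.
  by rewrite /w invmx_unitary// trmx_mul map_mxM trmxCK -u'T.
have E1 : f ((u *m A *m u^T) 0 0) = \sum_i D 0 i * `|w 0 i| ^+ 2.
  transitivity ((w *m diag_mx D *m (w ^t*)%sesqui) 0 0).
    rewrite wtE /w !mulmxA.
    rewrite -(mulmxA u') -(mulmxA u') -A'E.
    by rewrite /u' /A' map_trmx -!map_mxM [RHS]mxE.
  rewrite mxE; apply: eq_bigr => i _.
  by rewrite mul_mx_diag !mxE normCK mulrAC mulrC mulrA.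
have E2 : f ((u *m u^T) 0 0) = \sum_i `|w 0 i| ^+ 2.
  transitivity ((w *m (w ^t*)%sesqui) 0 0).
    rewrite wtE /w mulmxA mulmxKV//.
    by rewrite /u' map_trmx -map_mxM [RHS]mxE.
  by rewrite mxE; apply: eq_bigr => i _; rewrite !mxE normCK.
rewrite -lecR; change (f (l * (u *m u^T) 0 0) <= f ((u *m A *m u^T) 0 0)).
rewrite rmorphM E1 E2 mulr_sumr; apply: ler_sum => i _.
by rewrite ler_wpM2r// exprn_ge0.
Qed.

Lemma symmetric_form_le (R : rcfType) n (A : 'M[R]_n) (l : R) :
  A^T = A -> (forall a, eigenvalue A a -> a <= l) ->
  forall u : 'rV[R]_n, (u *m A *m u^T) 0 0 <= l * (u *m u^T) 0 0.
Proof.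
move=> Asym Al u; have NAsym : (- A)^T = - A by rewrite linearN/= Asym.
have NAl a : eigenvalue (- A) a -> - l <= a.
  move=> /eigenvalueP[v vA v0]; rewrite lerNl; apply: Al.
  by apply/eigenvalueP; exists v => //; rewrite scaleNr -vA mulmxN opprK.
have := symmetric_form_ge NAsym NAl u.
by rewrite mulmxN mulNmx [X in _ <= X]mxE mulNr lerN2.
Qed.

Lemma normmx_sum (R : comPzRingType) n (u : 'rV[R]_n) :
  (u *m u^T) 0 0 = \sum_p u 0 p ^+ 2.
Proof. by rewrite mxE; apply: eq_bigr => p _; rewrite mxE expr2. Qed.

Lemma form_sum (R : comPzRingType) n (A : 'M[R]_n) (u : 'rV[R]_n) :
  (u *m A *m u^T) 0 0 = \sum_p \sum_q A p q * (u 0 p * u 0 q).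
Proof.
rewrite mxE exchange_big /=; apply: eq_bigr => q _.
by rewrite !mxE mulr_suml; apply: eq_bigr => p _; ring.
Qed.

(* For A between 0 and K in the Loewner order, K (K^2 - A^2) is the sum of
   K^2 (K - A), (K - A) A (K - A) and A (K - A) A. *)
Lemma psd_normmx_le (R : realFieldType) n (A : 'M[R]_n) (K : R) :
  A^T = A -> 0 < K ->
  (forall u : 'rV[R]_n, 0 <= (u *m A *m u^T) 0 0 <= K * (u *m u^T) 0 0) ->
  forall u : 'rV[R]_n,
    (u *m A *m (u *m A)^T) 0 0 <= K ^+ 2 * (u *m u^T) 0 0.
Proof.
move=> Asym K0 AK u.
have /andP[_ H1] := AK u; have /andP[_ H2] := AK (u *m A).
have /andP[H3 _] := AK (K *: u - u *m A).
have AuT : (u *m A)^T = A *m u^T by rewrite trmx_mul Asym.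
move: H3; rewrite linearB/= linearZ/= !(mulmxBl, mulmxBr) -!scalemxAl -!scalemxAr.
rewrite AuT in H2 *.
rewrite !mulmxA in H1 H2 *.
set q := u *m A *m u^T in H1 *; set a := u *m A *m A *m u^T in H2 *.
set t := u *m A *m A *m A *m u^T in H2 *; set N := u *m u^T in H1 *.
clearbody q a t N; rewrite !mxE => H3.
have : 0 <= K * (K ^+ 2 * N 0 0 - a 0 0).
  have -> : K * (K ^+ 2 * N 0 0 - a 0 0) = K ^+ 2 * (K * N 0 0 - q 0 0) +
    (K * (K * q 0 0) - K * a 0 0 - (K * a 0 0 - t 0 0)) + (K * a 0 0 - t 0 0).
    by ring.
  apply: addr_ge0; last by rewrite subr_ge0.
  by apply: addr_ge0 => //; rewrite mulr_ge0 ?sqr_ge0 ?subr_ge0.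
by rewrite pmulr_rge0// subr_ge0.
Qed.

(** Cauchy-Schwarz through Lagrange's identity: twice the difference of the two sides is a double
    sum of squares. *)
Lemma sum_mul_sqr_le (R : realFieldType) (I : finType) (f g : I -> R) :
  (\sum_i f i * g i) ^+ 2 <= (\sum_i f i ^+ 2) * (\sum_i g i ^+ 2).
Proof.
have : 0 <= \sum_i \sum_j (f i * g j - f j * g i) ^+ 2.
  by apply: sumr_ge0 => i _; apply: sumr_ge0 => j _; exact: sqr_ge0.
have -> : \sum_i \sum_j (f i * g j - f j * g i) ^+ 2 =
   (\sum_i f i ^+ 2) * (\sum_i g i ^+ 2) *+ 2 - (\sum_i f i * g i) ^+ 2 *+ 2.
  transitivity (\sum_i \sum_j (f i ^+ 2 * g j ^+ 2 + g i ^+ 2 * f j ^+ 2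
      + (f i * g i) * (- 2 * (f j * g j)))).
    by apply: eq_bigr => i _; apply: eq_bigr => j _; ring.
  under eq_bigr do rewrite !big_split/= -!mulr_sumr.
  by rewrite !big_split/= -!mulr_suml; ring.
rewrite subr_ge0 lerMn2r//.
Qed.

(** * The graph Laplacian as a positive semidefinite form *)

Section laplacian.
Variables (R : realFieldType) (n : nat) (adj : rel 'I_n).
Hypothesis adj_sym : forall i j, adj i j = adj j i.
Hypothesis adj_irr : forall i, ~~ adj i i.

Lemma laplacianE i j : laplacian R adj i j =
  (i == j)%:R * (gdeg adj i)%:R - (adj i j)%:R.
Proof.
rewrite mxE; case: eqP => [->|_]; last by rewrite mul0r add0r.
by rewrite (negPf (adj_irr j)) subr0 mul1r.
Qed.

Lemma laplacian_sym : (laplacian R adj)^T = laplacian R adj.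
Proof.
apply/matrixP => i j; rewrite mxE !laplacianE adj_sym eq_sym.
by have [->|_] := eqVneq i j; rewrite ?mul0r.
Qed.

Lemma gdegE i : (gdeg adj i)%:R = \sum_j (adj i j)%:R :> R.
Proof.
rewrite /gdeg -sum1_card natr_sum big_mkcond; apply: eq_bigr => j _.
by rewrite inE; case: (adj i j).
Qed.

Lemma laplacian_row_sum i : \sum_j laplacian R adj i j = 0.
Proof.
under eq_bigr do rewrite laplacianE.
rewrite sumrB -gdegE (bigD1 i)//= eqxx mul1r big1 ?addr0 ?subrr// => j ji.
by rewrite eq_sym (negPf ji) mul0r.
Qed.

Lemma laplacian_form_ge0 (u : 'rV[R]_n) : 0 <= (u *m laplacian R adj *m u^T) 0 0.
Proof.
have FE : (u *m laplacian R adj *m u^T) 0 0 =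
    \sum_i \sum_j (adj i j)%:R * (u 0 i ^+ 2 - u 0 i * u 0 j).
  rewrite form_sum; apply: eq_bigr => i _.
  transitivity ((gdeg adj i)%:R * u 0 i ^+ 2 - \sum_j (adj i j)%:R * (u 0 i * u 0 j)).
    under eq_bigr do rewrite laplacianE mulrBl.
    rewrite sumrB; congr (_ - _); rewrite (bigD1 i)//= eqxx mul1r big1 ?addr0//.
    by move=> j ji; rewrite eq_sym (negPf ji) !mul0r.
  rewrite gdegE mulr_suml -sumrB; apply: eq_bigr => j _; ring.
(* Doubling the form and swapping the indices in one copy pairs the terms of (i, j) and (j, i); each
   pair adds up to [adj i j] times the square of [u 0 i - u 0 j]. *)
rewrite -(pmulrn_lge0 _ (isT : 0 < 2)%N) mulr2n {1}FE FE [X in _ <= _ + X]exchange_big/=.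
rewrite -big_split/=; apply: sumr_ge0 => i _.
rewrite -big_split/=; apply: sumr_ge0 => j _.
rewrite (adj_sym j i); have -> : (adj i j)%:R * (u 0 i ^+ 2 - u 0 i * u 0 j) +
  (adj i j)%:R * (u 0 j ^+ 2 - u 0 j * u 0 i) =
  (adj i j)%:R * (u 0 i - u 0 j) ^+ 2 :> R by ring.
by rewrite mulr_ge0 ?sqr_ge0.
Qed.
End laplacian.

(** * Block matrices indexed by agent and coordinate *)

Section bmat.
Variables (R : realFieldType) (n M : nat).

Lemma kidxK i k : kidx (mxvec_index i k) = (i, k) :> 'I_n * 'I_M.
Proof. by rewrite /kidx /mxvec_index cast_ordK enum_rankK. Qed.

Lemma big_kidx (F : 'I_n -> 'I_M -> R) :
  \sum_p F (kidx p).1 (kidx p).2 = \sum_i \sum_k F i k.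
Proof.
rewrite pair_big/= (reindex (uncurry (@mxvec_index n M))) /=; last first.
  exact: curry_mxvec_bij.
by apply: eq_bigr => -[i k] _; rewrite kidxK.
Qed.

Lemma Bmat_sym c (L : 'M[R]_n) (G : 'I_n -> 'M[R]_M) :
  L^T = L -> (forall i, (G i)^T = G i) -> (Bmat c L G)^T = Bmat c L G.
Proof.
move=> LT GT; apply/matrixP => p q; rewrite !mxE -[in LHS]LT mxE.
rewrite (eq_sym (kidx q).2) (eq_sym (kidx q).1).
by case: ((kidx p).1 =P _) => [->|]; rewrite ?mulr0 ?mul0r// -{1}GT mxE.
Qed.

(** The two ways of cutting a stacked vector: a block diagonal matrix acts on each agent block
    separately, a Kronecker product with the identity on each coordinate block. *)
Definition agent_block (u : 'rV[R]_(n * M)) (i : 'I_n) : 'rV[R]_M :=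
  \row_k u 0 (mxvec_index i k).
Definition coord_block (u : 'rV[R]_(n * M)) (k : 'I_M) : 'rV[R]_n :=
  \row_i u 0 (mxvec_index i k).

Lemma big_mxvec_index (F : 'I_(n * M) -> R) :
  \sum_p F p = \sum_i \sum_k F (mxvec_index i k).
Proof.
rewrite -(big_kidx (fun i k => F (mxvec_index i k))); apply: eq_bigr => p _.
by case/mxvec_indexP: p => i k; rewrite kidxK.
Qed.

Lemma norm_agent_block u :
  \sum_i (agent_block u i *m (agent_block u i)^T) 0 0 = (u *m u^T) 0 0.
Proof.
rewrite normmx_sum big_mxvec_index; apply: eq_bigr => i _.
by rewrite normmx_sum; apply: eq_bigr => k _; rewrite mxE.
Qed.

Lemma norm_coord_block u :
  \sum_k (coord_block u k *m (coord_block u k)^T) 0 0 = (u *m u^T) 0 0.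
Proof.
rewrite normmx_sum big_mxvec_index exchange_big; apply: eq_bigr => i _.
by rewrite normmx_sum; apply: eq_bigr => k _; rewrite mxE.
Qed.

(** In the entrywise expansion the factor [k == l] keeps the coordinate fixed and the factor
    [i == j] keeps the agent fixed. This decouples the spectral bounds: the Laplacian and the local
    Gram matrices can be estimated independently. *)
Lemma Bmat_form c (L : 'M[R]_n) (G : 'I_n -> 'M[R]_M) u :
  (u *m Bmat c L G *m u^T) 0 0 =
  \sum_k (coord_block u k *m L *m (coord_block u k)^T) 0 0 +
  c%:R * \sum_i (agent_block u i *m G i *m (agent_block u i)^T) 0 0.
Proof.
transitivity (\sum_i \sum_k \sum_j \sum_l
   (L i j * (k == l)%:R + c%:R * (i == j)%:R * G i k l) *
   (u 0 (mxvec_index i k) * u 0 (mxvec_index j l))).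
  rewrite form_sum big_mxvec_index; apply: eq_bigr => i _; apply: eq_bigr => k _.
  rewrite big_mxvec_index; apply: eq_bigr => j _; apply: eq_bigr => l _.
  by rewrite mxE !kidxK.
transitivity (\sum_i \sum_k \sum_j \sum_l
   (L i j * (k == l)%:R * (u 0 (mxvec_index i k) * u 0 (mxvec_index j l))) +
   \sum_i \sum_k \sum_j \sum_l (c%:R * (i == j)%:R * G i k l) *
   (u 0 (mxvec_index i k) * u 0 (mxvec_index j l))).
  do 2 (rewrite -big_split; apply: eq_bigr => ? _).
  do 2 (rewrite -big_split; apply: eq_bigr => ? _).
  by rewrite mulrDl.
congr (_ + _).
  rewrite exchange_big; apply: eq_bigr => k _; rewrite form_sum.
  apply: eq_bigr => i _; apply: eq_bigr => j _; rewrite !mxE.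
  rewrite (bigD1 k)//= eqxx mulr1 big1 ?addr0// => l lk.
  by rewrite eq_sym (negPf lk) mulr0 mul0r.
rewrite mulr_sumr; apply: eq_bigr => i _; rewrite form_sum mulr_sumr.
apply: eq_bigr => k _; rewrite (bigD1 i)//= [X in _ + X]big1 ?addr0 => [|j ji].
  by rewrite mulr_sumr; apply: eq_bigr => l _; rewrite !mxE eqxx mulr1 !mulrA.
by rewrite big1 => // l _; rewrite eq_sym (negPf ji) mulr0 !mul0r.
Qed.
End bmat.

Lemma gram_form (R : realFieldType) c M (H : 'M[R]_(c, M)) (u : 'rV[R]_M) :
  (u *m (H^T *m H) *m u^T) 0 0 = \sum_j (\sum_l H j l * u 0 l) ^+ 2.
Proof.
have -> : u *m (H^T *m H) *m u^T = (u *m H^T) *m (u *m H^T)^T.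
  by rewrite trmx_mul trmxK !mulmxA.
rewrite normmx_sum; apply: eq_bigr => j _; rewrite mxE; congr (_ ^+ 2).
by apply: eq_bigr => l _; rewrite mxE mulrC.
Qed.

(** Cauchy-Schwarz in each of the [c] rows, whose squared norm is at most [b * M%:R]. *)
Lemma gram_form_le (R : realFieldType) c M (H : 'M[R]_(c, M)) (b : R)
    (u : 'rV[R]_M) :
  (forall j l, H j l ^+ 2 <= b) ->
  (u *m (H^T *m H) *m u^T) 0 0 <= b * M%:R * c%:R * (u *m u^T) 0 0.
Proof.
move=> Hb; rewrite gram_form normmx_sum.
apply: (@le_trans _ _ (\sum_(j < c) (b * M%:R * \sum_p u 0 p ^+ 2))).
  apply: ler_sum => j _; apply: le_trans (sum_mul_sqr_le _ _) _.
  apply: ler_wpM2r; first by apply: sumr_ge0 => i _; exact: sqr_ge0.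
  apply: le_trans (ler_sum _ (fun i _ => Hb j i)) _.
  by rewrite sumr_const card_ord mulr_natr.
by rewrite sumr_const card_ord -[X in X <= _]mulr_natr mulrAC.
Qed.

(** * Expectation of products of independent variables *)

Section factorization.
Context d (T : measurableType d) (R : realType) (P : probability T R).
Implicit Types (h g : T -> R).
Import HBNNSimple.

Lemma ge0_integral_mul_nnsfun_comp h g (phi : {nnsfun R >-> R}) :
  (forall w, 0 <= h w) -> measurable_fun setT h -> measurable_fun setT g ->
  (\int[P]_w (h w * phi (g w))%:E =
  \sum_(k \in range phi) k%:E * \int[P]_(w in g @^-1` (phi @^-1` [set k])) (h w)%:E)%E.
Proof.
move=> h0 mh mg.
have mA k : measurable (g @^-1` (phi @^-1` [set k])).
  by rewrite -[X in measurable X]setTI; exact: mg.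
have pos k w : (0 <= (h w)%:E * (k * \1_(phi @^-1` [set k]) (g w))%:E)%E.
  by rewrite mule_ge0// ?lee_fin// -lee_fin EFinM nnfun_muleindic_ge0.
transitivity (\int[P]_w (\sum_(k \in range phi)
    ((h w)%:E * (k * \1_(phi @^-1` [set k]) (g w))%:E)))%E.
  apply: eq_integral => w _.
  rewrite [in LHS]fimfunE EFinM -fsumEFin// ge0_mule_fsumr// => k.
  by rewrite EFinM nnfun_muleindic_ge0.
rewrite ge0_integral_fsum//; last first.
  move=> k; apply: emeasurable_funM; apply/measurable_EFinP => //.
  apply: measurable_funM => //.
  by apply: measurableT_comp.
apply: eq_fsbigr => k; rewrite inE => -[y _ <-{k}].
rewrite [in RHS]integral_mkcond epatch_indic -ge0_integralZl//.
- by apply: eq_integral => w _ /=; rewrite EFinM muleCA.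
- apply: emeasurable_funM => //; exact/measurable_EFinP.
- by move=> w _; rewrite mule_ge0// lee_fin.
- by rewrite lee_fin.
Qed.

Lemma ge0_integral_factor h g (c : R) :
  (forall w, 0 <= h w) -> measurable_fun setT h ->
  (forall w, 0 <= g w) -> measurable_fun setT g ->
  (forall B, measurable B ->
     (\int[P]_(w in g @^-1` B) (h w)%:E = c%:E * P (g @^-1` B))%E) ->
  (\int[P]_w (h w * g w)%:E = c%:E * \int[P]_w (g w)%:E)%E.
Proof.
move=> h0 mh g0 mg hc.
(* The approximated function has to be nonnegative on the whole line; the absolute value is, and it
   is the identity on the values of [g]. *)
have mn : measurable_fun [set: R] (fun x : R => `|x|%:E).
  exact/measurable_EFinP.
pose f_ := nnsfun_approx measurableT mn.
have f_cvg w : (f_ n (g w))%:E @[n --> \oo] --> (g w)%:E.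
  have := @cvg_nnsfun_approx _ _ _ _ measurableT _ mn _ (g w) I.
  by rewrite ger0_norm//; apply => x _; rewrite lee_fin.
have mf n : measurable_fun setT (fun w => f_ n (g w)) by exact: measurableT_comp.
(* Used twice: with [h] for the left-hand side and with the constant 1 for the integral of [g]. *)
have lim_mul h' : (forall w, 0 <= h' w) -> measurable_fun setT h' ->
    (\int[P]_w (h' w * f_ n (g w))%:E @[n --> \oo] --> \int[P]_w (h' w * g w)%:E)%E.
  move=> h'0 mh'.
  have -> : (\int[P]_w (h' w * g w)%:E =
      \int[P]_w limn (fun n => (h' w * f_ n (g w))%:E))%E.
    apply: eq_integral => w _; apply/esym/cvg_lim => //.
    by under eq_fun do rewrite EFinM; rewrite EFinM; apply: cvgeZl.
  apply: cvg_monotone_convergence => //.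
  - by move=> n; apply/measurable_EFinP/measurable_funM.
  - by move=> n w _; rewrite lee_fin mulr_ge0.
  - move=> w _ m n mn'; rewrite lee_fin ler_wpM2l//.
    exact/lefP/nd_nnsfun_approx.
have H1 := lim_mul h h0 mh.
have H2 : (\int[P]_w (h w * f_ n (g w))%:E @[n --> \oo] -->
    c%:E * \int[P]_w (g w)%:E)%E.
  have H3 := lim_mul (cst 1) (fun=> ler01) (measurable_cst _).
  under eq_integral => w _ do rewrite -[g w]mul1r.
  apply: cvg_trans (cvgeZl _ H3) => //.
  apply: near_eq_cvg; apply: nearW => n.
  rewrite !ge0_integral_mul_nnsfun_comp// ge0_mule_fsumr; last first.
    move=> k; have [k0|k0] := leP 0 k.
      by rewrite mule_ge0 ?lee_fin// integral_ge0// => w _; rewrite lee_fin.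
    rewrite preimage_nnfun0// preimage_set0 integral_set0 mule0//.
  apply: eq_fsbigr => k _; rewrite muleCA; congr (_ * _)%E.
  have mA : measurable (g @^-1` (f_ n @^-1` [set k])).
    by rewrite -[X in measurable X]setTI; exact: mg.
  by rewrite hc// -[X in (_ = _ * X)%E]mul1e -(integral_cst P mA 1%E).
exact: cvg_unique H1 H2.
Qed.
End factorization.

(** Only the type of the domain changes, to the sigma-algebra generated by [G], so the closure
    properties of [measurable_fun] apply as they are. *)
Definition measurable_wrt d (T : measurableType d) (R : realType)
    (G : set (set T)) (f : T -> R) :=
  measurable_fun [set: g_sigma_algebraType G] (f : g_sigma_algebraType G -> R).

Definition rintegrable d (T : measurableType d) (R : realType)
  (P : probability T R) (f : T -> R) := P.-integrable setT (EFin \o f).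

Section measurable_wrt.
Context d (T : measurableType d) (R : realType).
Implicit Types (f g : T -> R) (G : set (set T)).

Lemma measurable_wrt_preimage G f B :
  measurable_wrt G f -> measurable B -> <<s G >> (f @^-1` B).
Proof. by move=> mf mB; have := mf measurableT B mB; rewrite setTI. Qed.

Lemma measurable_wrt_sub G G' f :
  <<s G >> `<=` <<s G' >> -> measurable_wrt G f -> measurable_wrt G' f.
Proof. by move=> GG' mf mT B mB; apply: GG'; exact: mf. Qed.

Lemma measurable_wrt_fun G f :
  G `<=` measurable -> measurable_wrt G f -> measurable_fun setT f.
Proof.
move=> Gm mf mT B mB; apply: (smallest_sub _ Gm); last exact: mf.
exact: sigma_algebra_measurable.
Qed.

Lemma measurable_wrt_cst G (r : R) : measurable_wrt G (cst r).
Proof. exact: measurable_cst. Qed.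

Lemma measurable_wrtD G f g : measurable_wrt G f -> measurable_wrt G g ->
  measurable_wrt G (fun w => f w + g w).
Proof. exact: measurable_funD. Qed.

Lemma measurable_wrtB G f g : measurable_wrt G f -> measurable_wrt G g ->
  measurable_wrt G (fun w => f w - g w).
Proof. exact: measurable_funB. Qed.

Lemma measurable_wrtM G f g : measurable_wrt G f -> measurable_wrt G g ->
  measurable_wrt G (fun w => f w * g w).
Proof. exact: measurable_funM. Qed.

Lemma measurable_wrt_norm G f : measurable_wrt G f ->
  measurable_wrt G (fun w => `|f w|).
Proof. by move=> mf; apply: measurableT_comp. Qed.

Lemma measurable_wrt_sum G (I : finType) (f : I -> T -> R) :
  (forall i, measurable_wrt G (f i)) -> measurable_wrt G (fun w => \sum_i f i w).
Proof. by move=> mf; apply: measurable_sum. Qed.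

Lemma measurable_wrt_gen G f :
  (forall B, measurable B -> G (f @^-1` B)) -> measurable_wrt G f.
Proof. by move=> Gf _ B mB; rewrite setTI; apply: sub_sigma_algebra; exact: Gf. Qed.
End measurable_wrt.

Section rintegrable.
Context d (T : measurableType d) (R : realType) (P : probability T R).
Implicit Types f g : T -> R.

Lemma rintegrable_measurable f : rintegrable P f -> measurable_fun setT f.
Proof. by move=> /integrableP[/measurable_EFinP]. Qed.

Lemma RintegralK f : rintegrable P f ->
  (\int[P]_w (f w)%:E = (\int[P]_w f w)%R%:E)%E.
Proof. by move=> fi; rewrite fineK//; apply: integrable_fin_num. Qed.

Lemma rintegrableD f g : rintegrable P f -> rintegrable P g ->
  rintegrable P (fun w => f w + g w).
Proof. by move=> fi gi; exact: (integrableD measurableT fi gi). Qed.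

Lemma rintegrableB f g : rintegrable P f -> rintegrable P g ->
  rintegrable P (fun w => f w - g w).
Proof. by move=> fi gi; exact: (integrableB measurableT fi gi). Qed.

Lemma rintegrableZ (r : R) f : rintegrable P f -> rintegrable P (fun w => r * f w).
Proof. by move=> fi; exact: (integrableZl measurableT r fi). Qed.

Lemma rintegrable_norm f : rintegrable P f -> rintegrable P (fun w => `|f w|).
Proof. by move=> fi; exact: (integrable_norm fi). Qed.

Lemma rintegrable_cst (r : R) : rintegrable P (cst r).
Proof. exact: finite_measure_integrable_cst. Qed.

Lemma rintegrable_le f g : measurable_fun setT f -> rintegrable P g ->
  (forall w, `|f w| <= g w) -> rintegrable P f.
Proof.
move=> mf gi fg; apply: (le_integrable measurableT _ _ gi).
  exact/measurable_EFinP.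
move=> w _ /=; rewrite lee_fin; apply: le_trans (fg w) _; exact: ler_norm.
Qed.

Lemma rintegrable_sum (I : finType) (f : I -> T -> R) :
  (forall i, rintegrable P (f i)) -> rintegrable P (fun w => \sum_i f i w).
Proof.
move=> fi; have := @integrable_sum _ _ _ P setT measurableT I (index_enum I) xpredT
  (fun i => EFin \o f i) (fun i _ => fi i).
by congr integrable; apply/funext => w /=; rewrite sumEFin.
Qed.

Lemma Rintegral_sum (I : finType) (f : I -> T -> R) :
  (forall i, rintegrable P (f i)) ->
  \int[P]_w (\sum_i f i w) = \sum_i \int[P]_w f i w.
Proof.
move=> fi; rewrite /Rintegral.
under eq_integral do rewrite -sumEFin.
rewrite integral_sum; last 2 first.
- exact: measurableT.
- by move=> i; exact: fi.
under eq_bigr do rewrite RintegralK//.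
by rewrite sumEFin.
Qed.

End rintegrable.

(** * Products of three independent factors *)

Section product.
Context d (T : measurableType d) (R : realType) (P : probability T R).
Variables G1 G2 G3 : set (set T).
Hypotheses (G2m : G2 `<=` measurable) (G3m : G3 `<=` measurable).
Hypothesis ind : indep3 P <<s G1 >> <<s G2 >> <<s G3 >>.
Implicit Types f g h : T -> R.

Let sub_measurable (G : set (set T)) A : G `<=` measurable -> <<s G >> A -> measurable A.
Proof. by move=> Gm; apply: smallest_sub => //; exact: sigma_algebra_measurable. Qed.

(* The indicator functions in the hypothesis of independence are replaced by
   f1, f2, f3 one at a time. *)
Lemma ge0_integral_mul3 f1 f2 f3 :
  measurable_wrt G1 f1 -> measurable_wrt G2 f2 -> measurable_wrt G3 f3 ->
  rintegrable P f1 -> rintegrable P f2 -> rintegrable P f3 ->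
  (forall w, 0 <= f1 w) -> (forall w, 0 <= f2 w) -> (forall w, 0 <= f3 w) ->
  (\int[P]_w (f1 w * f2 w * f3 w)%:E =
  ((\int[P]_w f1 w) * (\int[P]_w f2 w) * (\int[P]_w f3 w))%R%:E)%E.
Proof.
move=> w1 w2 w3 i1 i2 i3 p1 p2 p3.
have m1 := rintegrable_measurable i1; have m2 := rintegrable_measurable i2.
have m3 := rintegrable_measurable i3.
have mG1 B : measurable B -> <<s G1 >> (f1 @^-1` B) by exact: measurable_wrt_preimage.
have mG2 B : measurable B -> <<s G2 >> (f2 @^-1` B) by exact: measurable_wrt_preimage.
have mG3 B : measurable B -> <<s G3 >> (f3 @^-1` B) by exact: measurable_wrt_preimage.
have PK A : measurable A -> (P A = (fine (P A))%:E)%E.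
  by move=> mA; rewrite fineK// fin_num_measure.
have T1 : <<s G1 >> setT by exact: (@measurableT _ (g_sigma_algebraType G1)).
have S1 A2 A3 : <<s G2 >> A2 -> <<s G3 >> A3 ->
    (\int[P]_(w in A2 `&` A3) (f1 w)%:E =
    (\int[P]_w f1 w)%R%:E * (P A2 * P A3))%E.
  move=> GA2 GA3; have mA2 := sub_measurable G2m GA2; have mA3 := sub_measurable G3m GA3.
  have mA : measurable (A2 `&` A3) by exact: measurableI.
  rewrite integral_mkcond epatch_indic.
  (* The whole space as first event yields the independence of the other two. *)
  have P23 : (P (A2 `&` A3) = P A2 * P A3)%E.
    by have := ind T1 GA2 GA3; rewrite setTI probability_setT mul1e.
  under eq_integral do rewrite /= muleC -EFinM.
  rewrite (@ge0_integral_factor _ _ _ _ _ _ (fine (P (A2 `&` A3)))) => //.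
  - by rewrite -PK// RintegralK// P23 muleC.
  - move=> B mB; rewrite integral_indic//; last first.
      by rewrite -[X in measurable X]setTI; exact: m1.
    rewrite -(PK _ mA) (setIC _ (f1 @^-1` B)) setIA P23 (muleC (P A2 * P A3)%E) muleA.
    exact: ind (mG1 B mB) GA2 GA3.
have S2 A3 : <<s G3 >> A3 ->
    (\int[P]_(w in A3) (f1 w * f2 w)%:E =
    (\int[P]_w f1 w)%R%:E * (\int[P]_w f2 w)%R%:E * P A3)%E.
  move=> GA3; have mA3 := sub_measurable G3m GA3.
  rewrite integral_mkcond epatch_indic.
  under eq_integral do rewrite /= -EFinM mulrAC.
  rewrite (@ge0_integral_factor _ _ _ _ _ _ (fine (P A3) * \int[P]_w f1 w)%R).
  - by rewrite EFinM -PK// RintegralK// -muleA muleC.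
  - by move=> w; rewrite mulr_ge0.
  - by apply: measurable_funM.
  - by [].
  - by [].
  - move=> B mB; rewrite EFinM -PK// (muleC (P A3)) -muleA (muleC (P A3)).
    rewrite -S1//; last exact: mG2.
    by rewrite integral_mkcondr epatch_indic; apply: eq_integral => w _ /=; rewrite EFinM.
rewrite (@ge0_integral_factor _ _ _ _ _ _ ((\int[P]_w f1 w) * \int[P]_w f2 w)%R).
- by rewrite RintegralK.
- by move=> w; rewrite mulr_ge0.
- exact: measurable_funM.
- by [].
- by [].
- by move=> B mB; rewrite S2 ?EFinM//; exact: mG3.
Qed.

Let Rintegral_diff F A B (a b : R) : (forall w, F w = A w - B w) ->
  rintegrable P A /\ \int[P]_w A w = a -> rintegrable P B /\ \int[P]_w B w = b ->
  rintegrable P F /\ \int[P]_w F w = a - b.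
Proof.
move=> FE [Ai <-] [Bi <-]; have -> : F = (fun w => A w - B w) by exact/funext.
by split; [exact: rintegrableB|rewrite RintegralB].
Qed.

(* A signed f is the difference of |f| and |f| - f, both nonnegative. *)
Let signed_ind (G : set (set T)) (Q : (T -> R) -> Prop) :
  (forall f p, rintegrable P f -> rintegrable P p ->
     Q p -> Q (fun w => p w - f w) -> Q f) ->
  (forall f, measurable_wrt G f -> rintegrable P f -> (forall w, 0 <= f w) -> Q f) ->
  forall f, measurable_wrt G f -> rintegrable P f -> Q f.
Proof.
move=> Qsub Q0 f wf fi; have ni := rintegrable_norm fi.
have wn := measurable_wrt_norm wf.
apply: (Qsub f (fun w => `|f w|)) => //.
  by apply: Q0 => // w; exact: normr_ge0.
apply: Q0; first exact: measurable_wrtB.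
- exact: rintegrableB.
- by move=> w; rewrite subr_ge0 ler_norm.
Qed.

(** Integrability of the product belongs to the claim: it does not follow from that of the factors
    alone, but from the finite value found in the nonnegative case. Both parts pass to differences,
    so the sign restriction is lifted one factor at a time. *)
Lemma Rintegral_mul3 f1 f2 f3 :
  measurable_wrt G1 f1 -> measurable_wrt G2 f2 -> measurable_wrt G3 f3 ->
  rintegrable P f1 -> rintegrable P f2 -> rintegrable P f3 ->
  rintegrable P (fun w => f1 w * f2 w * f3 w) /\
  \int[P]_w (f1 w * f2 w * f3 w) =
    (\int[P]_w f1 w) * (\int[P]_w f2 w) * (\int[P]_w f3 w).
Proof.
pose Q f1 f2 f3 := rintegrable P (fun w => f1 w * f2 w * f3 w) /\
  \int[P]_w (f1 w * f2 w * f3 w) =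
    (\int[P]_w f1 w) * (\int[P]_w f2 w) * (\int[P]_w f3 w).
move=> w1 w2 w3 i1 i2 i3; rewrite -/(Q f1 f2 f3).
move: f1 w1 i1; apply: signed_ind => [f p fi pi Qp Qn|f1 w1 i1 p1].
  rewrite /Q (_ : _ * _ * _ = (\int[P]_w p w) * (\int[P]_w f2 w) * (\int[P]_w f3 w) -
     (\int[P]_w (p w - f w)) * (\int[P]_w f2 w) * (\int[P]_w f3 w)).
    by apply: Rintegral_diff Qp Qn => w; ring.
  by rewrite RintegralB//; ring.
move: f2 w2 i2; apply: signed_ind => [f p fi pi Qp Qn|f2 w2 i2 p2].
  rewrite /Q (_ : _ * _ * _ = (\int[P]_w f1 w) * (\int[P]_w p w) * (\int[P]_w f3 w) -
     (\int[P]_w f1 w) * (\int[P]_w (p w - f w)) * (\int[P]_w f3 w)).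
    by apply: Rintegral_diff Qp Qn => w; ring.
  by rewrite RintegralB//; ring.
move: f3 w3 i3; apply: signed_ind => [f p fi pi Qp Qn|f3 w3 i3 p3].
  rewrite /Q (_ : _ * _ * _ = (\int[P]_w f1 w) * (\int[P]_w f2 w) * (\int[P]_w p w) -
     (\int[P]_w f1 w) * (\int[P]_w f2 w) * (\int[P]_w (p w - f w))).
    by apply: Rintegral_diff Qp Qn => w; ring.
  by rewrite RintegralB//; ring.
have E := ge0_integral_mul3 w1 w2 w3 i1 i2 i3 p1 p2 p3.
split; last by rewrite /Rintegral E.
apply/integrableP; split.
  apply/measurable_EFinP/measurable_funM; last exact: rintegrable_measurable i3.
  apply: measurable_funM; [exact: rintegrable_measurable i1|exact: rintegrable_measurable i2].
under eq_integral do rewrite /= ger0_norm ?mulr_ge0//.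
by rewrite E ltry.
Qed.
End product.

(** * Mean square of one step of the recursion *)

Lemma Rintegral_one d (T : measurableType d) (R : realType) (P : probability T R) :
  \int[P]_w (cst 1 w : R) = 1.
Proof. by have := expectation_cst P 1; rewrite unlock /Rintegral => ->. Qed.

(** * Square-integrable random variables *)

Section square_integrable.
Context d (T : measurableType d) (R : realType) (P : probability T R).
Implicit Types f g : T -> R.

Definition square_integrable f :=
  measurable_fun setT f /\ rintegrable P (fun w => f w ^+ 2).

Lemma rintegrable_bounded f (b : R) : measurable_fun setT f ->
  (forall w, `|f w| <= b) -> rintegrable P f.
Proof. by move=> mf fb; exact: rintegrable_le mf (rintegrable_cst P b) fb. Qed.

Lemma square_integrable_mul f g : square_integrable f -> square_integrable g ->
  rintegrable P (fun w => f w * g w).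
Proof.
move=> [mf fi] [mg gi]; apply: rintegrable_le (rintegrableD fi gi) _.
  exact: measurable_funM.
move=> w; rewrite normrM -(real_normK (num_real (f w))) -(real_normK (num_real (g w))).
have := sqr_ge0 (`|f w| - `|g w|); have := sqr_ge0 (`|f w| + `|g w|); lra.
Qed.

Lemma square_integrableD f g : square_integrable f -> square_integrable g ->
  square_integrable (fun w => f w + g w).
Proof.
move=> fs gs; split; first by apply: measurable_funD; [case: fs|case: gs].
have -> : (fun w => (f w + g w) ^+ 2) =
    (fun w => f w ^+ 2 + (2 * (f w * g w) + g w ^+ 2)).
  by apply/funext => w; ring.
apply: rintegrableD; first by case: fs.
by apply: rintegrableD; [exact/rintegrableZ/square_integrable_mul|case: gs].
Qed.

Lemma square_integrable_sum (I : finType) (f : I -> T -> R) :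
  (forall i, square_integrable (f i)) -> square_integrable (fun w => \sum_i f i w).
Proof.
move=> fi; elim: (index_enum I) => [|i s ih].
  under eq_fun do rewrite big_nil.
  split; first exact: measurable_cst.
  exact: (rintegrable_cst P (0 ^+ 2)).
by under eq_fun do rewrite big_cons; exact: square_integrableD.
Qed.

Lemma square_integrable_bounded_mul f g (b : R) :
  measurable_fun setT f -> (forall w, `|f w| <= b) ->
  square_integrable g -> square_integrable (fun w => f w * g w).
Proof.
move=> mf fb [mg gi]; split; first exact: measurable_funM.
apply: rintegrable_le (rintegrableZ (b ^+ 2) gi) _.
  by apply: measurable_funX; exact: measurable_funM.
move=> w; rewrite ger0_norm ?sqr_ge0// exprMn ler_wpM2r ?sqr_ge0//.
by rewrite -(real_normK (num_real (f w))) lerXn2r ?nnegrE// (le_trans _ (fb w)).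
Qed.

Lemma square_integrable_cst (r : R) : square_integrable (cst r).
Proof. by split; [exact: measurable_cst|exact: (rintegrable_cst P (r ^+ 2))]. Qed.

Lemma square_integrableB f g : square_integrable f -> square_integrable g ->
  square_integrable (fun w => f w - g w).
Proof.
move=> fs gs; under eq_fun do rewrite -mulN1r; apply: square_integrableD => //.
apply: (@square_integrable_bounded_mul (cst (-1)) g 1) => // w.
by rewrite normrN1.
Qed.

Lemma square_integrable_rintegrable f : square_integrable f -> rintegrable P f.
Proof.
move=> fs; have := square_integrable_mul fs (square_integrable_cst 1).
by under eq_fun do rewrite mulr1.
Qed.
End square_integrable.

(** * One step of the recursion for an abstract symmetric random gain *)

Section one_step.
Context d (T : measurableType d) (R : realType) (P : probability T R).
Variables G1 G2 G3 : set (set T).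
Hypotheses (G1m : G1 `<=` measurable) (G2m : G2 `<=` measurable)
  (G3m : G3 `<=` measurable).
Hypothesis ind : indep3 P <<s G1 >> <<s G2 >> <<s G3 >>.

Variables (m c : nat) (A : T -> 'M[R]_m) (B : 'M[R]_m) (K l : R).
Hypothesis A_sym : forall w, (A w)^T = A w.
Hypothesis K_gt0 : 0 < K.
Hypothesis A_form : forall w (u : 'rV[R]_m),
  0 <= (u *m A w *m u^T) 0 0 <= K * (u *m u^T) 0 0.
Hypothesis A_wrt : forall p q, measurable_wrt G1 (fun w => A w p q).
Hypothesis A_mean : forall p q, \int[P]_w A w p q = B p q.
Hypothesis B_form : forall u : 'rV[R]_m, l * (u *m u^T) 0 0 <= (u *m B *m u^T) 0 0.

Variables (C V : 'I_m -> 'I_c -> T -> R) (b sigma : R).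
Hypothesis C_wrt : forall p k, measurable_wrt G1 (C p k).
Hypothesis C_bounded : forall w p k, C p k w ^+ 2 <= b.
Hypothesis V_wrt : forall p k, measurable_wrt G2 (V p k).
Hypothesis V_sqi : forall p k, square_integrable P (V p k).
Hypothesis V_mean : forall p k, \int[P]_w V p k w = 0.
Hypothesis V_cov : forall p k k',
  \int[P]_w (V p k w * V p k' w) = sigma ^+ 2 * (k == k')%:R.

Variables (e : T -> 'rV[R]_m).
Hypothesis e_wrt : forall p, measurable_wrt G3 (fun w => e w 0 p).
Hypothesis e_sqi : forall p, square_integrable P (fun w => e w 0 p).

Variable alpha : R.
Hypothesis alpha_ge0 : 0 <= alpha.

Let N w : 'rV[R]_m := \row_p \sum_k C p k w * V p k w.
Let rho : R := 1 - 2 * alpha * l + alpha ^+ 2 * K ^+ 2.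
Let normsq (u : 'rV[R]_m) := \sum_p u 0 p ^+ 2.

(** The monomials of the cross term, of the squared noise and of the quadratic form. Each is
    bracketed as an input factor, a noise factor and a past factor, with a literal 1 for a missing
    one, which is the shape that [Rintegral_mul3] expects. *)
Let X (p q : 'I_m) k w : R := ((p == q)%:R - alpha * A w q p) * C p k w * V p k w * e w 0 q.
Let Y p k k' w : R := C p k w * C p k' w * (V p k w * V p k' w) * 1.
Let F p q w : R := A w p q * 1 * (e w 0 p * e w 0 q).

(** Applied to a basis vector, [psd_normmx_le] bounds the norm of a row of [A w] by [K], hence each
    of its entries. *)
Let A_bounded w p q : `|A w p q| <= K.
Proof.
have := psd_normmx_le (A_sym w) K_gt0 (A_form w) (delta_mx 0 p).
have -> : ((delta_mx 0 p : 'rV[R]_m) *m (delta_mx 0 p : 'rV[R]_m)^T) 0 0 = 1.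
  by rewrite trmx_delta mul_delta_mx mxE !eqxx.
rewrite mulr1 -rowE normmx_sum (bigD1 q)//= mxE => le_K.
rewrite -(ler_pXn2r (isT : 0 < 2)%N) ?nnegrE ?normr_ge0 ?(ltW K_gt0)// real_normK ?num_real//.
by apply: le_trans le_K; rewrite lerDl sumr_ge0// => j _; exact: sqr_ge0.
Qed.

Let A_int p q : rintegrable P (fun w => A w p q).
Proof.
apply: (@rintegrable_bounded _ _ _ _ _ K) => //.
exact: measurable_wrt_fun G1m (A_wrt p q).
Qed.

Let C_int p k k' : rintegrable P (fun w => C p k w * C p k' w).
Proof.
apply: (@rintegrable_bounded _ _ _ _ _ b) => [|w].
  by apply: measurable_funM; exact: measurable_wrt_fun G1m (C_wrt _ _).
have := C_bounded w p k; have := C_bounded w p k'.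
rewrite normrM -(real_normK (num_real (C p k w))) -(real_normK (num_real (C p k' w))).
have := sqr_ge0 (`|C p k w| - `|C p k' w|); lra.
Qed.

(** From [2 * y <= y ^+ 2 + 1]; the value only serves integrability, and this choice avoids a square
    root of [b]. *)
Let C_abs p k w : `|C p k w| <= b + 1.
Proof.
have := C_bounded w p k; rewrite -(real_normK (num_real (C p k w))).
have := sqr_ge0 (`|C p k w| - 1); have := normr_ge0 (C p k w); lra.
Qed.

Let X_int p q k : rintegrable P (X p q k) /\ \int[P]_w X p q k w = 0.
Proof.
have wC : measurable_wrt G1 (fun w => ((p == q)%:R - alpha * A w q p) * C p k w).
  apply: measurable_wrtM => //; apply: measurable_wrtB; first exact: measurable_wrt_cst.
  by apply: measurable_wrtM => //; exact: measurable_wrt_cst.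
have [|||Xi XE] := Rintegral_mul3 G2m G3m ind wC (V_wrt p k) (e_wrt q).
- apply: (@rintegrable_bounded _ _ _ _ _ ((1 + alpha * K) * (b + 1))) => [|w].
    exact: measurable_wrt_fun G1m wC.
  rewrite normrM ler_pM//; apply: le_trans (ler_normB _ _) _.
  rewrite lerD// ?normrM ?(ger0_norm alpha_ge0) ?ler_wpM2l//.
  by case: (p == q); rewrite ?normr1 ?normr0.
- exact: square_integrable_rintegrable.
- exact: square_integrable_rintegrable.
by split => //; rewrite /X XE V_mean mulr0 mul0r.
Qed.

Let Y_int p k k' : rintegrable P (Y p k k') /\
  \int[P]_w Y p k k' w = (\int[P]_w (C p k w * C p k' w)) * (sigma ^+ 2 * (k == k')%:R).
Proof.
have [|||Yi YE] := Rintegral_mul3 G2m G3m ind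
  (measurable_wrtM (C_wrt p k) (C_wrt p k')) (measurable_wrtM (V_wrt p k) (V_wrt p k'))
  (measurable_wrt_cst (G := G3) (1 : R)).
- exact: C_int.
- exact: square_integrable_mul.
- exact: rintegrable_cst.
split => //; rewrite /Y YE V_cov.
by rewrite Rintegral_one mulr1.
Qed.

Let F_int p q : rintegrable P (F p q) /\
  \int[P]_w F p q w = B p q * \int[P]_w (e w 0 p * e w 0 q).
Proof.
have [|||Fi FE] := Rintegral_mul3 G2m G3m ind (A_wrt p q)
  (measurable_wrt_cst (G := G2) (1 : R)) (measurable_wrtM (e_wrt p) (e_wrt q)).
- exact: A_int.
- exact: rintegrable_cst.
- exact: square_integrable_mul.
split => //; rewrite /F FE A_mean.
by rewrite Rintegral_one mulr1.
Qed.

Let e2_int p : rintegrable P (fun w => e w 0 p ^+ 2).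
Proof. by case: (e_sqi p). Qed.

Let sumF_int : rintegrable P (fun w => \sum_p \sum_q F p q w).
Proof.
by apply: rintegrable_sum => p; apply: rintegrable_sum => q; case: (F_int p q).
Qed.

Let norme_int : rintegrable P (fun w => normsq (e w)).
Proof. exact: rintegrable_sum. Qed.

Let sumF_ge : l * (\int[P]_w normsq (e w)) <= \int[P]_w (\sum_p \sum_q F p q w).
Proof.
rewrite [X in _ <= X]Rintegral_sum => [|p]; last first.
  by apply: rintegrable_sum => q; case: (F_int p q).
under eq_bigr => p _ do rewrite (Rintegral_sum (fun q => proj1 (F_int p q))).
under eq_bigr => p _ do under eq_bigr => q _ do rewrite (proj2 (F_int p q)).
have ee_int p q : rintegrable P (fun w => e w 0 p * e w 0 q).
  exact: square_integrable_mul.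
have -> : \sum_p \sum_q B p q * \int[P]_w (e w 0 p * e w 0 q) =
    \int[P]_w (e w *m B *m (e w)^T) 0 0.
  under [RHS]eq_Rintegral do rewrite form_sum.
  rewrite Rintegral_sum => [|p]; last first.
    by apply: rintegrable_sum => q; exact: rintegrableZ.
  apply: eq_bigr => p _; rewrite Rintegral_sum => [|q]; last exact: rintegrableZ.
  by apply: eq_bigr => q _; rewrite RintegralZl//; exact: ee_int.
rewrite -RintegralZl//; apply: le_Rintegral => //.
- exact: (rintegrableZ l norme_int).
- suff : rintegrable P (fun w => \sum_p \sum_q B p q * (e w 0 p * e w 0 q)).
    by congr integrable; apply/funext => w /=; rewrite form_sum.
  by apply: rintegrable_sum => p; apply: rintegrable_sum => q; exact: rintegrableZ.
- by move=> w _; rewrite /normsq -normmx_sum.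
Qed.

Let sumFE w : \sum_p \sum_q F p q w = (e w *m A w *m (e w)^T) 0 0.
Proof.
by rewrite form_sum; apply: eq_bigr => p _; apply: eq_bigr => q _; rewrite /F mulr1.
Qed.

(** The quadratic form stays random on the right, since its lower bound through [B] is valid only
    after integration. *)
Let step_le w : normsq (e w - alpha *: (e w *m A w)) <=
  (1 + alpha ^+ 2 * K ^+ 2) * normsq (e w) - 2 * alpha * \sum_p \sum_q F p q w.
Proof.
have := psd_normmx_le (A_sym w) K_gt0 (A_form w) (e w).
rewrite sumFE !normmx_sum -/(normsq _) -/(normsq _) => /(ler_wpM2l (sqr_ge0 alpha)).
have -> : normsq (e w - alpha *: (e w *m A w)) =
  normsq (e w) - 2 * alpha * (e w *m A w *m (e w)^T) 0 0 +
  alpha ^+ 2 * normsq (e w *m A w).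
  have -> : (e w *m A w *m (e w)^T) 0 0 = \sum_p (e w *m A w) 0 p * e w 0 p.
    by rewrite mxE; apply: eq_bigr => p _; rewrite [_^T _ _]mxE.
  rewrite /normsq !mulr_sumr -sumrB -big_split; apply: eq_bigr => p _ /=.
  by rewrite [in LHS]mxE [in X in _ + X]mxE [in X in _ + X]mxE; ring.
lra.
Qed.

(* This holds because the mean square of e - alpha e A is nonnegative, and it
   spares a proof that rho itself is nonnegative. *)
Lemma contraction_ge0 : 0 <= rho * \int[P]_w normsq (e w).
Proof.
have : 0 <= \int[P]_w ((1 + alpha ^+ 2 * K ^+ 2) * normsq (e w)
    - 2 * alpha * \sum_p \sum_q F p q w).
  apply: Rintegral_ge0 => w _; apply: le_trans (step_le w).
  by apply: sumr_ge0 => p _; exact: sqr_ge0.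
rewrite RintegralB//; [|exact: (rintegrableZ _ norme_int)|exact: (rintegrableZ _ sumF_int)].
rewrite !RintegralZl//.
have := ler_wpM2l (mulr_ge0 (ler0n R 2) alpha_ge0) sumF_ge.
rewrite /rho; lra.
Qed.

Let normN w : normsq (N w) = \sum_p \sum_k \sum_k' Y p k k' w.
Proof.
apply: eq_bigr => p _; rewrite mxE expr2 mulr_suml; apply: eq_bigr => k _.
by rewrite mulr_sumr; apply: eq_bigr => k' _; rewrite /Y; ring.
Qed.

Let crossE w : \sum_p (e w - alpha *: (e w *m A w)) 0 p * N w 0 p =
  \sum_p \sum_q \sum_k X p q k w.
Proof.
apply: eq_bigr => p _.
have -> : (e w - alpha *: (e w *m A w)) 0 p =
    \sum_q ((p == q)%:R - alpha * A w q p) * e w 0 q.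
  under eq_bigr do rewrite mulrBl.
  rewrite sumrB !mxE mulr_sumr; congr (_ - _).
    rewrite (bigD1 p)//= eqxx mul1r big1 ?addr0// => q qp.
    by rewrite eq_sym (negPf qp) mul0r.
  by apply: eq_bigr => q _; ring.
rewrite mulr_suml; apply: eq_bigr => q _; rewrite [N w _ _]mxE mulr_sumr.
by apply: eq_bigr => k _; rewrite /X; ring.
Qed.

Let sumX_int : rintegrable P (fun w => \sum_p \sum_q \sum_k X p q k w).
Proof.
apply: rintegrable_sum => p; apply: rintegrable_sum => q.
by apply: rintegrable_sum => k; case: (X_int p q k).
Qed.

Let sumX_eq0 : \int[P]_w (\sum_p \sum_q \sum_k X p q k w) = 0.
Proof.
rewrite Rintegral_sum => [|p]; last first.
  by apply: rintegrable_sum => q; apply: rintegrable_sum => k; case: (X_int p q k).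
rewrite big1// => p _; rewrite Rintegral_sum => [|q]; last first.
  by apply: rintegrable_sum => k; case: (X_int p q k).
rewrite big1// => q _; rewrite Rintegral_sum => [|k]; last by case: (X_int p q k).
by rewrite big1// => k _; case: (X_int p q k).
Qed.

Let sumY_int : rintegrable P (fun w => \sum_p \sum_k \sum_k' Y p k k' w).
Proof.
apply: rintegrable_sum => p; apply: rintegrable_sum => k.
by apply: rintegrable_sum => k'; case: (Y_int p k k').
Qed.

(** Distinct noise entries are uncorrelated, so among the pairs [k], [k'] only the diagonal
    survives: [m * c] terms, each at most [b * sigma ^+ 2]. *)
Let sumY_le : \int[P]_w (\sum_p \sum_k \sum_k' Y p k k' w) <=
  m%:R * c%:R * b * sigma ^+ 2.
Proof.
rewrite Rintegral_sum => [|p]; last first.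
  by apply: rintegrable_sum => k; apply: rintegrable_sum => k'; case: (Y_int p k k').
apply: (@le_trans _ _ (\sum_(p < m) \sum_(k < c) b * sigma ^+ 2)); last first.
  by rewrite !sumr_const !card_ord -[X in X <= _]mulr_natl -[X in _ * X]mulr_natl !mulrA.
apply: ler_sum => p _; rewrite Rintegral_sum => [|k]; last first.
  by apply: rintegrable_sum => k'; case: (Y_int p k k').
apply: ler_sum => k _; rewrite Rintegral_sum => [|k']; last by case: (Y_int p k k').
rewrite (bigD1 k)//= big1 => [|k' k'k]; last first.
  by have [_ ->] := Y_int p k k'; rewrite eq_sym (negPf k'k) !mulr0.
have [_ ->] := Y_int p k k; rewrite eqxx mulr1 addr0 ler_wpM2r ?sqr_ge0//.
rewrite -[leRHS]mulr1 -(Rintegral_one P) -RintegralZl//; last exact: (rintegrable_cst P 1).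
apply: le_Rintegral => //; first exact: C_int.
- exact: (rintegrableZ b (rintegrable_cst P 1)).
- by move=> w _; rewrite /= mulr1 -expr2.
Qed.

Lemma mean_square_step :
  \int[P]_w normsq (e w - alpha *: (e w *m A w) + alpha *: N w) <=
  rho * (\int[P]_w normsq (e w)) + alpha ^+ 2 * (m%:R * c%:R * b * sigma ^+ 2).
Proof.
have stepE w : normsq (e w - alpha *: (e w *m A w) + alpha *: N w) =
    normsq (e w - alpha *: (e w *m A w)) +
    2 * alpha * (\sum_p \sum_q \sum_k X p q k w) +
    alpha ^+ 2 * \sum_p \sum_k \sum_k' Y p k k' w.
  rewrite -crossE -normN /normsq !mulr_sumr -!big_split; apply: eq_bigr => p _ /=.
  set z := e w - _; rewrite [in LHS]mxE [X in (_ + X) ^+ 2]mxE; ring.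
have e_meas p : measurable_fun setT (fun w => e w 0 p) by case: (e_sqi p).
have iN := rintegrableZ (1 + alpha ^+ 2 * K ^+ 2) norme_int.
have iF := rintegrableZ (2 * alpha) sumF_int.
have iX := rintegrableZ (2 * alpha) sumX_int.
have iY := rintegrableZ (alpha ^+ 2) sumY_int.
have bound_int : rintegrable P (fun w => (1 + alpha ^+ 2 * K ^+ 2) * normsq (e w)
    - 2 * alpha * (\sum_p \sum_q F p q w) +
    2 * alpha * (\sum_p \sum_q \sum_k X p q k w) +
    alpha ^+ 2 * \sum_p \sum_k \sum_k' Y p k k' w).
  exact: (rintegrableD (rintegrableD (rintegrableB iN iF) iX) iY).
have bound_le w : normsq (e w - alpha *: (e w *m A w) + alpha *: N w) <=
    (1 + alpha ^+ 2 * K ^+ 2) * normsq (e w)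
    - 2 * alpha * (\sum_p \sum_q F p q w) +
    2 * alpha * (\sum_p \sum_q \sum_k X p q k w) +
    alpha ^+ 2 * \sum_p \sum_k \sum_k' Y p k k' w.
  by rewrite stepE !lerD2r.
(* The left-hand side is nonnegative and dominated by the bound, whose integrability is known
   monomial by monomial. *)
have step_int : rintegrable P (fun w =>
    normsq (e w - alpha *: (e w *m A w) + alpha *: N w)).
  apply: rintegrable_le bound_int _ => [|w]; last first.
    by rewrite ger0_norm//; apply: sumr_ge0 => p _; exact: sqr_ge0.
  apply: measurable_sum => p; apply: measurable_funX.
  under eq_fun do rewrite !mxE.
  apply: measurable_funD; first apply: measurable_funB => //.
  - apply: measurable_funM => //; apply: measurable_sum => q.
    by apply: measurable_funM => //; exact: measurable_wrt_fun G1m (A_wrt _ _).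
  - apply: measurable_funM => //; apply: measurable_sum => k; apply: measurable_funM.
      exact: measurable_wrt_fun G1m (C_wrt _ _).
    by case: (V_sqi p k).
have := le_Rintegral measurableT step_int bound_int (fun w _ => bound_le w).
move/le_trans; apply.
rewrite RintegralD//; last exact: (rintegrableD (rintegrableB iN iF) iX).
rewrite RintegralD//; last exact: (rintegrableB iN iF).
rewrite RintegralB// !RintegralZl// sumX_eq0.
have := ler_wpM2l (mulr_ge0 (ler0n R 2) alpha_ge0) sumF_ge.
have := ler_wpM2l (sqr_ge0 alpha) sumY_le.
rewrite /rho; lra.
Qed.
End one_step.

(** * The estimation error *)

(* If rho < 0, the hypothesis 0 <= rho * a t forces a = 0. *)
Lemma limn_esup_affine_recursion (R : realType) (a : nat -> R) (rho beta : R) :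
  (forall t, 0 <= a t) -> (forall t, 0 <= rho * a t) -> rho < 1 -> 0 <= beta ->
  (forall t, a t.+1 <= rho * a t + beta) ->
  (limn_esup (fun t => (a t)%:E) <= (beta / (1 - rho))%:E)%E.
Proof.
move=> a0 rhoa0 rho1 beta0 step; set s := beta / (1 - rho).
have rho1' : 0 < 1 - rho by rewrite subr_gt0.
have s0 : 0 <= s by rewrite divr_ge0// ltW.
(* The truncation makes [r ^+ t] nonnegative and convergent to 0 for either sign of [rho], so one
   majorant serves both cases. *)
pose r := Num.max rho 0.
have r0 : 0 <= r by rewrite le_max lexx orbT.
have r1 : r < 1 by rewrite gt_max rho1 ltr01.
have sE : beta = s * (1 - rho) by rewrite /s divfK// gt_eqF.
have a_le t : a t <= r ^+ t * a 0%N + s.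
  have [rho_ge0|rho_lt0] := leP 0 rho; last first.
    have at0 : a t <= 0 by have := rhoa0 t; rewrite nmulr_rge0.
    by rewrite (le_trans at0)// addr_ge0// mulr_ge0// exprn_ge0.
  have rE : r = rho by rewrite /r max_l.
  rewrite rE; elim: t => [|t ih]; first by rewrite expr0 mul1r lerDl.
  apply: le_trans (step t) _; rewrite exprS.
  have := ler_wpM2l rho_ge0 ih; rewrite {1}sE; lra.
pose u t := (r ^+ t * a 0%N + s)%:E.
have ru : (r ^+ t * a 0%N + s) @[t --> \oo] --> (0 * a 0%N + s).
  by apply: cvgD; [apply: cvgMl; apply: cvg_expr; rewrite ger0_norm|exact: cvg_cst].
have u_cvg : u t @[t --> \oo] --> s%:E.
  rewrite mul0r add0r in ru.
  by apply/fine_cvgP; split; [exact: nearW|exact: ru].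
rewrite -(cvg_limn_einf_sup u_cvg).2 !limn_esup_lim.
apply: lee_lim; [exact: is_cvg_esups|exact: is_cvg_esups|].
apply: nearW => t; apply: ge_ereal_sup => _ [k /= tk <-].
apply: (@le_trans _ _ (u k)); first by rewrite lee_fin.
by apply: ereal_sup_ubound; exists k.
Qed.

Section estimation_error.
Context (R : realType) (dT : measure_display) (T : measurableType dT)
  (P : probability T R) (dX : measure_display) (X : measurableType dX) (W : Type).
Variables (n M c : nat) (phi : X -> W -> R) (omega : 'I_M -> W) (theta : 'cV[R]_M)
  (x : nat -> 'I_n -> 'I_c -> T -> X) (v : nat -> 'I_n -> 'I_c -> T -> R)
  (th0 : 'I_n -> T -> 'cV[R]_M) (adj : rel 'I_n) (alpha : R).
Hypothesis phi_meas : forall l, measurable_fun setT (fun a => phi a (omega l)).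
Hypothesis phi_le : forall a w, `|phi a w| <= Num.sqrt 2.
Hypothesis x_meas : forall t i j, measurable_fun setT (x t i j).
Hypothesis v_sqi : forall t i k, square_integrable P (v t i k).
Hypothesis th0_sqi : forall i k, square_integrable P (fun w => th0 i w k 0).
Hypothesis adj_sym : forall i j, adj i j = adj j i.
Hypothesis adj_irr : forall i, ~~ adj i i.

(** These three generating classes repeat the independence hypothesis of the theorem verbatim, so
    that it applies by conversion. *)
Definition input_events t : set (set T) :=
  gen_class (fun a : 'I_n * 'I_c => x t a.1 a.2).
Definition noise_events t : set (set T) :=
  gen_class (fun a : 'I_n * 'I_c => v t a.1 a.2).
Definition past_events t : set (set T) :=
  gen_class (fun a : 'I_n * 'I_M => fun w => th0 a.1 w a.2 0)
  `|` gen_class (fun a : {s : nat | (s < t)%N} * 'I_n * 'I_c =>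
                    x (sval a.1.1) a.1.2 a.2)
  `|` gen_class (fun a : {s : nat | (s < t)%N} * 'I_n * 'I_c =>
                    v (sval a.1.1) a.1.2 a.2).

Let L := laplacian R adj.
Let H t i w := Hmat phi omega (fun j => x t i j w).

Definition error t w : 'rV[R]_(n * M) :=
  \row_p (est phi omega theta (netP adj alpha) alpha x v th0 t (kidx p).1 w
            (kidx p).2 0 - theta (kidx p).2 0).
(** The coefficient is 1 instead of [c] because the unnormalized Gram matrix has mean [c] times
    [G i]; thus the mean of the gain is the matrix B ([gain_mean]). *)
Definition gain t w : 'M[R]_(n * M) := Bmat 1 L (fun i => (H t i w)^T *m H t i w).
Definition feature t (p : 'I_(n * M)) (k : 'I_c) w : R := H t (kidx p).1 w k (kidx p).2.
Definition noise t (p : 'I_(n * M)) (k : 'I_c) : T -> R := v t (kidx p).1 k.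

Lemma gain_sym t w : (gain t w)^T = gain t w.
Proof.
apply: Bmat_sym; first exact: laplacian_sym.
by move=> i; rewrite trmx_mul trmxK.
Qed.

(** The rows of the Laplacian sum to zero, so averaging with [netP] fixes the common vector [theta],
    and the innovation is the noise minus [H] applied to the local error. *)
Lemma error_step t w : error t.+1 w = error t w - alpha *: (error t w *m gain t w)
  + alpha *: \row_p \sum_k feature t p k w * noise t p k w.
Proof.
apply/rowP => p; case/mxvec_indexP: p => i k.
(* Errors are stored as rows but the estimates are columns; symmetry of the gain mediates. *)
have -> : error t w *m gain t w = (gain t w *m (error t w)^T)^T.
  by rewrite trmx_mul trmxK gain_sym.
pose z j := est phi omega theta (netP adj alpha) alpha x v th0 t j w.
have eE j l : (error t w)^T (mxvec_index j l) 0 = z j l 0 - theta l 0.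
  by rewrite !mxE kidxK.
have gE : (gain t w *m (error t w)^T) (mxvec_index i k) 0 =
    \sum_j L i j * (z j k 0 - theta k 0) +
    ((H t i w)^T *m (H t i w *m (z i - theta))) k 0.
  rewrite mulmxA mxE big_mxvec_index.
  have E j l : gain t w (mxvec_index i k) (mxvec_index j l) =
      L i j * (k == l)%:R + (i == j)%:R * ((H t i w)^T *m H t i w) k l.
    by rewrite mxE !kidxK mul1r.
  under eq_bigr => j _ do under eq_bigr => l _ do rewrite E eE mulrDl.
  under eq_bigr do rewrite big_split/=.
  rewrite big_split/=; congr (_ + _).
    apply: eq_bigr => j _; rewrite (bigD1 k)//= eqxx mulr1 big1 ?addr0// => l lk.
    by rewrite eq_sym (negPf lk) mulr0 mul0r.
  rewrite (bigD1 i)//= [X in _ + X]big1 ?addr0 => [|j ji]; last first.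
    by rewrite big1 => // l _; rewrite eq_sym (negPf ji) !mul0r.
  rewrite [RHS]mxE; apply: eq_bigr => l _; rewrite eqxx mul1r; congr (_ * _).
  by rewrite !mxE.
have zE : est phi omega theta (netP adj alpha) alpha x v th0 t.+1 i w =
    \sum_j netP adj alpha i j *: z j + alpha *: ((H t i w)^T *m
      (H t i w *m theta + \col_k v t i k w - H t i w *m z i)).
  by [].
have netE : (\sum_j netP adj alpha i j *: z j) k 0 - theta k 0 =
    z i k 0 - theta k 0 - alpha * \sum_j L i j * (z j k 0 - theta k 0).
  have -> : \sum_j L i j * (z j k 0 - theta k 0) = \sum_j L i j * z j k 0.
    under eq_bigr do rewrite mulrBr.
    by rewrite sumrB -mulr_suml laplacian_row_sum// mul0r subr0.
  have PE j : netP adj alpha i j = (i == j)%:R - alpha * L i j by rewrite !mxE.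
  have -> : (\sum_j netP adj alpha i j *: z j) k 0 =
      z i k 0 - alpha * \sum_j L i j * z j k 0; last by ring.
  rewrite summxE mulr_sumr.
  under eq_bigr do rewrite mxE PE mulrBl -mulrA.
  rewrite sumrB (bigD1 i)//= eqxx mul1r big1 ?addr0 => [|j ji]//.
  by rewrite eq_sym (negPf ji) mul0r.
have nE : \sum_k0 feature t (mxvec_index i k) k0 w * noise t (mxvec_index i k) k0 w =
    ((H t i w)^T *m \col_k v t i k w) k 0.
  by rewrite [RHS]mxE; apply: eq_bigr => j _; rewrite /feature /noise kidxK !mxE.
have innE : (H t i w)^T *m (H t i w *m theta + \col_k v t i k w - H t i w *m z i) =
    (H t i w)^T *m \col_k v t i k w - (H t i w)^T *m (H t i w *m (z i - theta)).
  rewrite addrAC -mulmxBr mulmxDr addrC; congr (_ + _).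
  by rewrite -mulmxN -mulmxN opprB.
have fE : (\row_p \sum_k feature t p k w * noise t p k w) 0 (mxvec_index i k) =
    ((H t i w)^T *m \col_k v t i k w) k 0 by rewrite mxE nE.
rewrite [LHS]mxE kidxK/= -/(z i).
rewrite [RHS]mxE [X in _ = X + _]mxE [X in _ = _ + X]mxE fE.
rewrite [X in _ = X + _ + _]mxE kidxK/=.
rewrite [X in _ = _ + X + _]mxE [X in _ = _ - X + _]mxE [X in _ = _ - _ * X + _]mxE gE.
rewrite -/(est phi omega theta (netP adj alpha) alpha x v th0 t.+1 i w) zE innE.
rewrite [X in X - _ = _]mxE addrAC netE.
set a := (H t i w)^T *m \col_k v t i k w; set b := (H t i w)^T *m (H t i w *m (z i - theta)).
by rewrite [X in _ + X = _]mxE [X in _ + _ * X = _]mxE [X in _ + _ * (_ + X) = _]mxE; ring.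
Qed.

Let HE t i w j l : H t i w j l = phi (x t i j w) (omega l).
Proof. by rewrite mxE. Qed.

Let H_abs t i w j l : `|H t i w j l| <= Num.sqrt 2.
Proof. by rewrite HE. Qed.

Let H_sqr t i w j l : H t i w j l ^+ 2 <= 2.
Proof.
rewrite -(real_normK (num_real _)) -[leRHS](@sqr_sqrtr R 2)//.
by rewrite lerXn2r ?nnegrE ?sqrtr_ge0.
Qed.

Lemma feature_sqr t p k w : feature t p k w ^+ 2 <= 2.
Proof. exact: H_sqr. Qed.

(** The form at an eigenvector is the eigenvalue times a positive squared norm. The sign is needed
    for [K] to be nonnegative. *)
Lemma max_eigenvalue_laplacian_ge0 (lL : R) : is_max_eigenvalue L lL -> 0 <= lL.
Proof.
move=> [/eigenvalueP[u uL u0] _].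
have := laplacian_form_ge0 adj_sym adj_irr u.
rewrite -/L uL -scalemxAl mxE pmulr_lge0//.
rewrite normmx_sum lt_def sumr_ge0 ?andbT => [|i _]; last exact: sqr_ge0.
apply: contraNneq u0 => /psumr_eq0P u0; apply/eqP/rowP => i.
by rewrite mxE; apply/eqP; rewrite -sqrf_eq0 u0// => j _; exact: sqr_ge0.
Qed.

Lemma gain_form (lL : R) : is_max_eigenvalue L lL -> forall t w (u : 'rV[R]_(n * M)),
  0 <= (u *m gain t w *m u^T) 0 0 <= (lL + 2 * M%:R * c%:R) * (u *m u^T) 0 0.
Proof.
move=> lLP t w u; rewrite Bmat_form mul1r; apply/andP; split.
  apply: addr_ge0; first by apply: sumr_ge0 => k _; exact: laplacian_form_ge0.
  apply: sumr_ge0 => i _; rewrite gram_form; apply: sumr_ge0 => j _; exact: sqr_ge0.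
rewrite mulrDl; apply: lerD.
  rewrite -norm_coord_block mulr_sumr; apply: ler_sum => k _.
  apply: symmetric_form_le; first exact: laplacian_sym.
  by case: lLP.
rewrite -norm_agent_block mulr_sumr; apply: ler_sum => i _.
exact: gram_form_le.
Qed.

Lemma input_events_measurable t : input_events t `<=` measurable.
Proof.
by move=> _ [a [B mB ->]]; rewrite -[X in measurable X]setTI; exact: x_meas.
Qed.

Lemma noise_events_measurable t : noise_events t `<=` measurable.
Proof.
move=> _ [a [B mB ->]]; rewrite -[X in measurable X]setTI.
by apply: (proj1 (v_sqi t a.1 a.2)).
Qed.

Lemma past_events_measurable t : past_events t `<=` measurable.
Proof.
move=> _ [[|]|] [a [B mB ->]]; rewrite -[X in measurable X]setTI.
- by apply: (proj1 (th0_sqi a.1 a.2)).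
- exact: x_meas.
- by apply: (proj1 (v_sqi _ _ _)).
Qed.

Lemma past_events_le t : <<s past_events t >> `<=` <<s past_events t.+1 >>.
Proof.
apply: sub_sigma_algebra2 => A [[th0A|]|]; first by left; left.
  move=> [[[[s st] i] j] [B mB ->]]; left; right.
  by exists (exist (fun s => s < t.+1)%N s (ltnW st), i, j); exists B.
move=> [[[[s st] i] j] [B mB ->]]; right.
by exists (exist (fun s => s < t.+1)%N s (ltnW st), i, j); exists B.
Qed.

Lemma input_events_le t : <<s input_events t >> `<=` <<s past_events t.+1 >>.
Proof.
apply: sub_sigma_algebra2 => A [[i j] [B mB ->]]; left; right.
by exists (exist (fun s => s < t.+1)%N t (ltnSn t), i, j); exists B.
Qed.

Lemma noise_events_le t : <<s noise_events t >> `<=` <<s past_events t.+1 >>.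
Proof.
apply: sub_sigma_algebra2 => A [[i j] [B mB ->]]; right.
by exists (exist (fun s => s < t.+1)%N t (ltnSn t), i, j); exists B.
Qed.

Let H_wrt t i j l : measurable_wrt (input_events t) (fun w => H t i w j l).
Proof.
apply: measurable_wrt_gen => B mB; exists (i, j); exists ((phi ^~ (omega l)) @^-1` B).
  by rewrite -[X in measurable X]setTI; exact: phi_meas.
by apply/seteqP; split => w /=; rewrite HE.
Qed.

Lemma feature_wrt t p k : measurable_wrt (input_events t) (feature t p k).
Proof. exact: H_wrt. Qed.

Lemma noise_wrt t p k : measurable_wrt (noise_events t) (noise t p k).
Proof. by apply: measurable_wrt_gen => B mB; exists ((kidx p).1, k); exists B. Qed.

Let gainE t p q w : gain t w p q =
  L (kidx p).1 (kidx q).1 * ((kidx p).2 == (kidx q).2)%:R +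
  ((kidx p).1 == (kidx q).1)%:R *
    \sum_j H t (kidx p).1 w j (kidx p).2 * H t (kidx p).1 w j (kidx q).2.
Proof.
rewrite mxE mul1r; congr (_ + _ * _); rewrite mxE.
by apply: eq_bigr => j _; rewrite mxE.
Qed.

Lemma gain_wrt t p q : measurable_wrt (input_events t) (fun w => gain t w p q).
Proof.
under eq_fun do rewrite gainE.
apply: measurable_wrtD; first exact: measurable_wrt_cst.
apply: measurable_wrtM; first exact: measurable_wrt_cst.
by apply: measurable_wrt_sum => j; exact: measurable_wrtM.
Qed.

Let error_stepE t p w : error t.+1 w 0 p =
  error t w 0 p - alpha * (\sum_q error t w 0 q * gain t w q p) +
  alpha * \sum_k feature t p k w * noise t p k w.
Proof.
by rewrite error_step; move: (error t w) (gain t w) => E A; rewrite !mxE.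
Qed.

(** By [error_step], the next error is a polynomial in the current error and the inputs and noise of
    time [t], all of which belong to the past at time [t.+1]. *)
Lemma error_wrt t p : measurable_wrt (past_events t) (fun w => error t w 0 p).
Proof.
elim: t p => [|t ih] p.
  under eq_fun do rewrite mxE.
  apply: measurable_wrtB; last exact: measurable_wrt_cst.
  apply: measurable_wrt_gen => B mB; left; left.
  by exists (kidx p); exists B.
have ih' q := measurable_wrt_sub (@past_events_le t) (ih q).
have g' q := measurable_wrt_sub (@input_events_le t) (@gain_wrt t q p).
have f' k := measurable_wrt_sub (@input_events_le t) (@feature_wrt t p k).
have n' k := measurable_wrt_sub (@noise_events_le t) (@noise_wrt t p k).
under eq_fun do rewrite error_stepE.
apply: measurable_wrtD.
  apply: measurable_wrtB; first exact: ih'.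
  apply: measurable_wrtM; first exact: measurable_wrt_cst.
  by apply: measurable_wrt_sum => q; apply: measurable_wrtM; [exact: ih'|exact: g'].
apply: measurable_wrtM; first exact: measurable_wrt_cst.
by apply: measurable_wrt_sum => k; apply: measurable_wrtM; [exact: f'|exact: n'].
Qed.

Let gain_abs t p q w : `|gain t w p q| <= `|L (kidx p).1 (kidx q).1| + c%:R * 2.
Proof.
rewrite gainE (le_trans (ler_normD _ _))// lerD//.
  by rewrite normrM ler_piMr// normr_nat lern1 leq_b1.
rewrite normrM normr_nat (@le_trans _ _ (1 * (c%:R * 2)))//; last by rewrite mul1r.
rewrite ler_pM//; first by rewrite lern1 leq_b1.
apply: le_trans (ler_norm_sum _ _ _) _.
apply: (@le_trans _ _ (\sum_(j < c) (2 : R))); last first.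
  by rewrite sumr_const card_ord mulr_natl.
apply: ler_sum => j _; rewrite normrM -[leRHS](@sqr_sqrtr R 2)// expr2.
exact: ler_pM.
Qed.

(** Gain and features are bounded uniformly in the sample point, so multiplication by them preserves
    finite second moments. *)
Lemma error_sqi t p : square_integrable P (fun w => error t w 0 p).
Proof.
have scale r f : square_integrable P f -> square_integrable P (fun w => r * f w).
  by apply: (@square_integrable_bounded_mul _ _ _ _ (cst r) f `|r|).
elim: t p => [|t ih] p.
  under eq_fun do rewrite mxE.
  by apply: square_integrableB => //; exact: square_integrable_cst.
under eq_fun do rewrite error_stepE.
apply: square_integrableD.
  apply: square_integrableB => //; apply/scale/square_integrable_sum => q.
  under eq_fun do rewrite mulrC.
  apply: square_integrable_bounded_mul (ih q) => [|w]; last exact: gain_abs.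
  exact: measurable_wrt_fun (@input_events_measurable t) (@gain_wrt t q p).
apply/scale/square_integrable_sum => k.
apply: square_integrable_bounded_mul (v_sqi _ _ _) => [|w]; last exact: H_abs.
exact: measurable_wrt_fun (@input_events_measurable t) (@feature_wrt t p k).
Qed.

Lemma gain_mean (G : 'I_n -> 'M[R]_M) t p q :
  (forall i k l, G i k l = c%:R^-1 * \int[P]_w ((H t i w)^T *m H t i w) k l) ->
  \int[P]_w gain t w p q = Bmat c L G p q.
Proof.
move=> GE; pose S w := \sum_j H t (kidx p).1 w j (kidx p).2 * H t (kidx p).1 w j (kidx q).2.
have S_int : rintegrable P S.
  apply: rintegrable_sum => j.
  apply: (@rintegrable_bounded _ _ _ _ _ 2) => [|w].
    by apply: measurable_funM; apply: measurable_wrt_fun (@input_events_measurable t) _.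
  by rewrite normrM -[leRHS](@sqr_sqrtr R 2)// expr2 ler_pM.
have SE w : ((H t (kidx p).1 w)^T *m H t (kidx p).1 w) (kidx p).2 (kidx q).2 = S w.
  by rewrite mxE; apply: eq_bigr => j _; rewrite mxE.
under eq_Rintegral do rewrite gainE -/(S _).
rewrite RintegralD//; last exact: (rintegrableZ _ S_int); last exact: (rintegrable_cst P).
have E1 r : \int[P]_w (cst r w) = r :> R.
  have := RintegralZl r measurableT (rintegrable_cst P 1).
  by under eq_Rintegral do rewrite mulr1; rewrite Rintegral_one mulr1.
rewrite E1 (RintegralZl _ measurableT S_int) [RHS]mxE GE -/L; congr (_ + _).
rewrite (@eq_Rintegral _ _ _ P setT S) => [|w _]; last exact: SE.
have [c0|c0] := eqVneq (c%:R : R) 0; last by rewrite -[RHS]mulrA [RHS]mulrCA mulVKf.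
(* When c = 0 the factor c^-1 is 0 and the Gram matrix is an empty sum. *)
rewrite c0 !mul0r; have -> : S = cst 0.
  apply/funext => w; move/eqP: c0; rewrite pnatr_eq0 => /eqP c0.
  by rewrite /S big1// => j _; have := ltn_ord j; rewrite {2}c0.
by rewrite /Rintegral integral0 mulr0.
Qed.
End estimation_error.

Unset Implicit Arguments.
Set Strict Implicit.

Theorem theorem1
  (R : realType) (dT : measure_display) (T : measurableType dT)
  (P : probability T R)
  (dX : measure_display) (X : measurableType dX) (W : Type)
  (n M c : nat)
  (phi : X -> W -> R) (omega : 'I_M -> W) (theta : 'cV[R]_M)
  (x : nat -> 'I_n -> 'I_c -> T -> X)
  (v : nat -> 'I_n -> 'I_c -> T -> R)
  (th0 : 'I_n -> T -> 'cV[R]_M)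
  (sigv : R) (G : 'I_n -> 'M[R]_M)
  (adj : rel 'I_n) (alpha lB lL : R) :
  (* feature map: measurable in the input, bounded by sqrt 2 *)
  (forall l, measurable_fun setT (fun a => phi a (omega l))) ->
  (forall a w, `|phi a w| <= Num.sqrt 2) ->
  (* inputs and noise are random variables *)
  (forall t i j, measurable_fun setT (x t i j)) ->
  (forall t i k, measurable_fun setT (v t i k)) ->
  (* noise: zero mean, covariance sigma_v^2 I_c *)
  (forall t i k, P.-integrable setT (EFin \o v t i k)) ->
  (forall t i k, ('E_P[v t i k] = 0)%E) ->
  (forall t i k l, P.-integrable setT (fun w => (v t i k w * v t i l w)%R%:E)) ->
  (forall t i k l,
      ('E_P[(fun w => v t i k w * v t i l w)%R] = (sigv ^+ 2 * (k == l)%:R)%:E)%E) ->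
  (* initial estimates: random, with finite second moments *)
  (forall i k, measurable_fun setT (fun w => th0 i w k 0)) ->
  (forall i k, P.-integrable setT (fun w => ((th0 i w k 0) ^+ 2)%R%:E)) ->
  (* inputs and noise at time t independent of each other and of the past *)
  (forall t,
      indep3 P
        (<<s gen_class (fun a : 'I_n * 'I_c => x t a.1 a.2) >>)
        (<<s gen_class (fun a : 'I_n * 'I_c => v t a.1 a.2) >>)
        (<<s gen_class (fun a : 'I_n * 'I_M => fun w => th0 a.1 w a.2 0)
             `|` gen_class (fun a : {s : nat | (s < t)%N} * 'I_n * 'I_c =>
                               x (sval a.1.1) a.1.2 a.2)
             `|` gen_class (fun a : {s : nat | (s < t)%N} * 'I_n * 'I_c =>
                               v (sval a.1.1) a.1.2 a.2) >>)) ->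
  (* input distributions do not depend on t *)
  (forall t i j A, measurable A -> P (x t i j @^-1` A) = P (x 0%N i j @^-1` A)) ->
  (* G_i = c^{-1} E[H_{i,t}^T H_{i,t}] *)
  (forall t i k l,
      G i k l = c%:R^-1 * fine ('E_P[(fun w =>
        ((Hmat phi omega (fun j => x t i j w))^T
           *m Hmat phi omega (fun j => x t i j w)) k l)%R])%E) ->
  (forall i, (\rank (G i) < M)%N) ->
  (\sum_(i < n) G i) \in unitmx ->
  (* undirected connected graph *)
  (forall i j, adj i j = adj j i) ->
  (forall i, ~~ adj i i) ->
  (forall i j, connect adj i j) ->
  0 < alpha -> alpha < ((maxdeg adj)%:R)^-1 ->
  is_min_eigenvalue (Bmat c (laplacian R adj) G) lB ->
  is_max_eigenvalue (laplacian R adj) lL ->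
  alpha < 2 * lB / (lL + 2 * M%:R * c%:R) ^+ 2 ->
  (limn_esup (fun t => 'E_P[(fun w =>
      \sum_(i < n) \sum_(k < M)
        (est phi omega theta (netP adj alpha) alpha x v th0 t i w k 0
           - theta k 0) ^+ 2)%R])
   <= (2 * alpha * c%:R * M%:R * n%:R * sigv ^+ 2
       / (2 * lB - alpha * (lL + 2 * M%:R * c%:R) ^+ 2))%:E)%E.
Proof.
move=> phi_meas phi_le x_meas v_meas v_int v_mean vv_int v_cov th0_meas th0_int ind.
move=> _ GE _ _ adj_sym adj_irr _ alpha0 _ lBP lLP alpha_lt.
have v_sqi t i k : square_integrable P (v t i k).
  split=> //; have := vv_int t i k k; congr integrable.
have th0_sqi i k : square_integrable P (fun w => th0 i w k 0).
  by split; [exact: th0_meas|exact: th0_int].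
set L := laplacian R adj in lBP lLP *.
set K := lL + 2 * M%:R * c%:R in alpha_lt *.
have lL0 : 0 <= lL by exact: max_eigenvalue_laplacian_ge0 lLP.
have K_ge0 : 0 <= K by rewrite addr_ge0// !mulr_ge0.
(* For [K = 0] the quotient bounding [alpha] would be a division by zero, hence 0, against
   [0 < alpha]. *)
have K_gt0 : 0 < K.
  rewrite lt_def K_ge0 andbT; apply: contraTneq alpha_lt => ->.
  by rewrite expr0n invr0 mulr0 -leNgt ltW.
have gap : 0 < 2 * lB - alpha * K ^+ 2.
  by rewrite subr_gt0 -ltr_pdivlMr ?exprn_gt0.
have GE' t i k l : G i k l = c%:R^-1 * \int[P]_w ((Hmat phi omega (fun j => x t i j w))^T
    *m Hmat phi omega (fun j => x t i j w)) k l.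
  by rewrite (GE t) unlock.
have G_sym i : (G i)^T = G i.
  apply/matrixP => k l; rewrite mxE !(GE' 0%N); congr (_ * _).
  by apply: eq_Rintegral => w _; rewrite !mxE; apply: eq_bigr => j _; rewrite mulrC !mxE.
pose e := error phi omega theta x v th0 adj alpha.
pose a t := \int[P]_w \sum_p e t w 0 p ^+ 2.
have e_sqi t p : square_integrable P (fun w => e t w 0 p) by exact: error_sqi.
have aE t : ('E_P[(fun w => \sum_(i < n) \sum_(k < M)
    (est phi omega theta (netP adj alpha) alpha x v th0 t i w k 0 - theta k 0) ^+ 2)%R]
    = (a t)%:E)%E.
  rewrite unlock -RintegralK; last by apply: rintegrable_sum => p; case: (e_sqi t p).
  apply: eq_integral => w _; congr EFin; rewrite -big_kidx.
  by apply: eq_bigr => p _; rewrite mxE.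
under eq_fun do rewrite aE.
set rho : R := 1 - 2 * alpha * lB + alpha ^+ 2 * K ^+ 2.
(* The noise term of [mean_square_step] with [m = n * M] and [b = 2]. *)
pose beta : R := alpha ^+ 2 * ((n * M)%:R * c%:R * 2 * sigv ^+ 2).
have G1m := input_events_measurable x_meas.
have G2m := noise_events_measurable v_sqi.
have G3m := past_events_measurable x_meas v_sqi th0_sqi.
pose A := gain phi omega x adj.
have A_sym t w : (A t w)^T = A t w by exact: gain_sym.
have A_form t w (u : 'rV[R]_(n * M)) :
    0 <= (u *m A t w *m u^T) 0 0 <= K * (u *m u^T) 0 0 by exact: gain_form.
have A_mean t p q : \int[P]_w A t w p q = Bmat c L G p q by exact: gain_mean.
have B_form (u : 'rV[R]_(n * M)) :
    lB * (u *m u^T) 0 0 <= (u *m Bmat c L G *m u^T) 0 0.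
  apply: symmetric_form_ge; last by case: lBP.
  by apply: Bmat_sym => //; exact: laplacian_sym.
have A_wrt t p q : measurable_wrt (input_events x t) (fun w => A t w p q).
  exact: gain_wrt.
have e_wrt t p : measurable_wrt (past_events x v th0 t) (fun w => e t w 0 p).
  exact: error_wrt.
have pos t : 0 <= rho * a t.
  exact: (contraction_ge0 (G1m t) (G2m t) (G3m t) (ind t) (A_sym t) K_gt0 (A_form t)
    (A_wrt t) (A_mean t) B_form (e_wrt t) (e_sqi t) (ltW alpha0)).
have step t : a t.+1 <= rho * a t + beta.
  have -> : a t.+1 = \int[P]_w \sum_p (e t w - alpha *: (e t w *m A t w) +
      alpha *: \row_p \sum_k feature phi omega x t p k w * noise v t p k w) 0 p ^+ 2.
    by apply: eq_Rintegral => w _; rewrite -error_step.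
  apply: (mean_square_step (G1m t) (G2m t) (G3m t) (ind t) (A_sym t) K_gt0 (A_form t)
    (A_wrt t) (A_mean t) B_form _ _ _ _ _ _ (e_wrt t) (e_sqi t) (ltW alpha0)).
  - by move=> p k; exact: feature_wrt.
  - by move=> w p k; exact: feature_sqr.
  - by move=> p k; exact: noise_wrt.
  - by move=> p k; exact: v_sqi.
  - by move=> p k; have := v_mean t (kidx p).1 k; rewrite unlock /Rintegral => ->.
  - move=> p k k'; have := v_cov t (kidx p).1 k k'.
    by rewrite unlock /Rintegral /noise => ->.
have rhoE : 1 - rho = alpha * (2 * lB - alpha * K ^+ 2) by rewrite /rho; ring.
have -> : 2 * alpha * c%:R * M%:R * n%:R * sigv ^+ 2 / (2 * lB - alpha * K ^+ 2)
    = beta / (1 - rho).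
  rewrite rhoE /beta natrM; field.
  by rewrite !gt_eqF.
apply: limn_esup_affine_recursion => //.
- by move=> t; apply: Rintegral_ge0 => w _; apply: sumr_ge0 => p _; exact: sqr_ge0.
- by rewrite -subr_gt0 rhoE mulr_gt0.
- by apply: mulr_ge0; [exact: sqr_ge0|apply: mulr_ge0; [rewrite !mulr_ge0|exact: sqr_ge0]].
Qed.
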